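(* Let $G^{\varphi}$ be a connected complex unit gain graph with underlying graph $G$. Then $p(G^{\varphi})=m(G)-c(G)$ if and only if the following three conditions all hold: (a) any two (distinct) cycles of $G^{\varphi}$ share no common vertices; (b) each cycle of $G^{\varphi}$ is of Type A; (c) $m(T_{G})=m(G-O(G))$.
   Context: All graphs are finite and simple (no loops or multiple edges). A complex unit gain graph $G^{\varphi}$ consists of a graph $G$ (the underlying graph) with vertices $v_1,\dots,v_n$ and a function $\varphi$ assigning to each oriented edge $e_{ij}$ (from $v_i$ to $v_j$, where $v_iv_j\in E(G)$; both orientations of each edge are considered) a number $\varphi(e_{ij})=\varphi_{v_iv_j}\in\mathbb{T}=\{z\in\mathbb{C}:|z|=1\}$ such that $\varphi(e_{ij})=\varphi(e_{ji})^{-1}=\overline{\varphi(e_{ji})}$. Its adjacency matrix $A(G^{\varphi})$ is the $n\times n$ Hermitian matrix with $(i,j)$ entry $\varphi(e_{ij})$ if $v_iv_j\in E(G)$ and $0$ otherwise. $p(G^{\varphi})$ denotes the number of positive eigenvalues of $A(G^{\varphi})$, counted with multiplicity. $m(G)$ is the matching number of $G$ (with $m=0$ for a graph without vertices). $c(G)=|E(G)|-|V(G)|+\omega(G)$ is the cyclomatic number, where $\omega(G)$ is the number of connected components of $G$. Cycles of $G^{\varphi}$ are the cycles of $G$ with the restricted gains; $G^{\varphi}$ is connected if $G$ is. For a cycle $C_q$ with consecutive vertices $w_1,w_2,\dots,w_q$, $q\ge 3$, put $\varphi(C_q)=\varphi_{w_1w_2}\varphi_{w_2w_3}\cdots\varphi_{w_{q-1}w_q}\varphi_{w_qw_1}$.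 The cycle is of Type A if $q$ is even and $\varphi(C_q)=(-1)^{q/2}$ (this does not depend on the starting vertex or direction). $O(G)$ is the set of vertices lying on cycles of $G$, and $G-O(G)$ is the induced subgraph obtained by deleting these vertices. When the cycles of $G$ are pairwise vertex-disjoint, $T_G$ is the acyclic graph obtained from $G$ by contracting each cycle of $G$ to a single vertex (so $T_G=G$ if $G$ has no cycles); condition (c) is understood together with condition (a), under which $T_G$ is defined. *)

(* Defs.v *)
From HB Require Import structures.
From mathcomp Require Import all_boot all_order all_algebra.
From mathcomp Require Import boolp reals complex.

Set Implicit Arguments.
Unset Strict Implicit.
Unset Printing Implicit Defensive.

Import Order.TTheory GRing.Theory Num.Theory.

Record sgraph (T : finType) := SGraph {
  adj :> rel T;
  adj_sym : symmetric adj;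
  adj_irr : irreflexive adj
}.

Section Graphs.
Variables (T : finType) (G : sgraph T).

Definition edges : {set {set T}} :=
  [set e | [exists x, exists y, adj G x y && (e == [set x; y])]].

Definition num_components : nat := n_comp (adj G) T.

(* The graph without vertices is not connected. *)
Definition connected_graph : Prop := num_components = 1.

Definition cyclomatic : int :=
  (#|edges|%:Z - #|T|%:Z + num_components%:Z)%R.

Definition is_matching (M : {set {set T}}) : bool :=
  (M \subset edges) && trivIset M.

Definition matching_number : nat :=
  \max_(M : {set {set T}} | is_matching M) #|M|.

(* A cycle is given by its list of consecutive vertices w_1, ..., w_q. The same
   cycle has several such lists (rotations and reversals); it is determined by
   its set of edges. *)
Definition is_cycle (c : seq T) : bool :=
  (2 < size c) && ucycleb (adj G) c.

Definition cycle_edges (c : seq T) : {set {set T}} :=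
  [set [set x; next c x] | x in c].

Definition cycles_disjoint : Prop :=
  forall c1 c2 : seq T, is_cycle c1 -> is_cycle c2 ->
    cycle_edges c1 != cycle_edges c2 -> [disjoint c1 & c2].

Definition cycle_vertices : {set T} :=
  [set x | `[< exists2 c, is_cycle c & x \in c >]].

Fact induced_sym (A : {set T}) :
  symmetric (fun x y : {x : T | x \in A} => adj G (val x) (val y)).
Proof. by move=> x y; rewrite adj_sym. Qed.

Fact induced_irr (A : {set T}) :
  irreflexive (fun x y : {x : T | x \in A} => adj G (val x) (val y)).
Proof. by move=> x; rewrite adj_irr. Qed.

Definition induced (A : {set T}) : sgraph {x : T | x \in A} :=
  SGraph (@induced_sym A) (@induced_irr A).

Definition on_common_cycle : rel T :=
  fun x y => `[< exists c, [/\ is_cycle c, x \in c & y \in c] >].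

(* The vertices of the contracted graph are the vertex sets of the cycles and
   the singletons of the vertices on no cycle. If cycles share vertices, the
   cycles joined by a chain of such intersections are contracted together. *)
Definition cycle_classes : {set {set T}} :=
  equivalence_partition (connect on_common_cycle) [set: T].

Definition contracted_adj : rel {B : {set T} | B \in cycle_classes} :=
  fun B1 B2 => (B1 != B2) &&
    [exists x in val B1, exists y in val B2, adj G x y].

Fact contracted_sym : symmetric contracted_adj.
Proof.
move=> B1 B2; rewrite /contracted_adj eq_sym; congr (_ && _).
by apply/exists_inP/exists_inP => -[x xB /exists_inP[y yB xy]];
  exists y => //; apply/exists_inP; exists x => //; rewrite adj_sym.
Qed.

Fact contracted_irr : irreflexive contracted_adj.
Proof. by move=> B; rewrite /contracted_adj eqxx. Qed.

Definition contracted : sgraph {B : {set T} | B \in cycle_classes} :=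
  SGraph contracted_sym contracted_irr.

End Graphs.

Local Open Scope ring_scope.

(* Only the values on oriented edges matter. Since these have modulus 1, the
   inverse is also the complex conjugate. *)
Record unit_gain (C : numClosedFieldType) (T : finType) (G : sgraph T) :=
  UnitGain {
    gain :> T -> T -> C;
    gain_norm : forall x y, adj G x y -> `|gain x y| = 1;
    gain_inv : forall x y, adj G x y -> gain x y = (gain y x)^-1
  }.

Definition cycle_gain (C : numClosedFieldType) (T : finType) (G : sgraph T)
    (phi : unit_gain C G) (c : seq T) : C :=
  \prod_(x <- c) phi x (next c x).

Definition typeA (C : numClosedFieldType) (T : finType) (G : sgraph T)
    (phi : unit_gain C G) (c : seq T) : Prop :=
  ~~ odd (size c) /\ cycle_gain phi c = (-1) ^+ (size c)./2.

Definition gain_adjacency (C : numClosedFieldType) (n : nat)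
    (G : sgraph 'I_n) (phi : unit_gain C G) : 'M[C]_n :=
  \matrix_(i, j) (if adj G i j then phi i j else 0).

(* The eigenvalues of A with multiplicity: the list of roots of char_poly A. *)
Definition eigenvalues (C : numClosedFieldType) (n : nat) (A : 'M[C]_n) :
    seq C :=
  sval (closed_field_poly_normal (char_poly A)).

(* In a numClosedFieldType, 0 < z says that z is real and positive. *)
Definition num_pos_eigenvalues (C : numClosedFieldType) (n : nat)
    (A : 'M[C]_n) : nat :=
  count (fun z => 0 < z) (eigenvalues A).

(* Main.v *)
Require Import Defs.
From HB Require Import structures.
From mathcomp Require Import all_boot all_order all_algebra.
From mathcomp Require Import spectral zify ring.
From mathcomp Require Import boolp reals complex.

(** The lower bound [m - c <= p] ([pos_ge_matching]) comes from deleting a vertex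
    on a cycle: [p] does not increase, [m] drops by at most one and [c] by at least
    one.  What remains is a forest, where [m <= p] by peeling off leaves.  Call a
    graph extremal when the bound is attained.  In an extremal graph each of these
    inequalities is an equality, so deleting a vertex of a cycle keeps the graph
    extremal, keeps [p], and lowers [m] and [c] by exactly one.  As a vertex where
    two cycles diverge would lower [c] by two, condition (a) follows.

    The conditions suffice ([cactus_extremal]).  The contracted graph is always a
    forest, so by König's theorem it has a vertex cover as small as its matching
    number; under (c) such a cover contains no contracted cycle
    ([cover_off_cycles]).  Deleting the [m(G - O(G))] vertices of the cover leaves
    the disjoint cycles, and a Type A cycle of length [q] has positive index at
    most [q/2 - 1].  Subadditivity of the positive index gives
    [p <= m(G - O(G)) + sum (q/2 - 1)], while matching each cycle within itself
    gives [m >= m(G - O(G)) + sum q/2], and [c] is at most the number of cycles.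

    The conditions are necessary ([extremal_cactus]), by induction on the number
    of edges.  For (b), delete a vertex of another cycle or the neighbour of a leaf,
    keeping the given cycle and extremality, until that cycle carries all the
    edges; there an explicit vector, supported on every other vertex of the cycle,
    decides between [q/2 - 1] and [q/2] ([cycle_vector]).  For (c), the main point
    is that no maximum matching joins a cycle to its outside ([no_crossing]).  If
    it used [uv] with [u] on a cycle and [v] off it, then [G - u] and [G - u - v]
    would both be extremal with the same positive index.  By induction they satisfy
    the three conditions, which are unchanged when all gains are negated, so the
    sufficiency part makes the negative indices equal as well.  Hence row [v] of
    the adjacency matrix of [G - u] depends on the other rows, and putting [u] back
    behind the bridge [uv] raises the positive index, against extremality
    ([pos_hyperbolic]).  Therefore [m <= m(G - O(G)) + sum q/2].  Conversely, a
    maximum matching of the contracted graph lifts to [G], and deleting from each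
    cycle a vertex next to the one used by the lift gives
    [m >= m(T) + sum q/2] for the contracted graph [T] ([matching_transversal]). *)

Set Implicit Arguments.
Unset Strict Implicit.
Unset Printing Implicit Defensive.

Import Order.TTheory GRing.Theory Num.Theory.

(** * Subgraphs on a fixed vertex set *)

Section Subgraphs.
Variable T : finType.
Implicit Types (G H : sgraph T) (A B S K : {set T}) (M N : {set {set T}}) (x y u v : T).

Lemma set2_eq a b c d : [set a; b] = [set c; d] :> {set T} ->
  (a = c /\ b = d) \/ (a = d /\ b = c).
Proof.
move=> eqs.
have /set2P ha : a \in [set c; d] by rewrite -eqs set21.
have /set2P hb : b \in [set c; d] by rewrite -eqs set22.
have /set2P hc : c \in [set a; b] by rewrite eqs set21.
have /set2P hd : d \in [set a; b] by rewrite eqs set22.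
by case: ha => ?; case: hb => ?; case: hc => ?; case: hd => ?; subst; auto.
Qed.

Lemma edgesP G (e : {set T}) :
  reflect (exists x y, adj G x y /\ e = [set x; y]) (e \in edges G).
Proof.
rewrite inE; apply: (iffP existsP) => [[x /existsP[y /andP[xy /eqP ->]]]|].
  by exists x, y.
by move=> [x [y [xy ->]]]; exists x; apply/existsP; exists y; rewrite xy eqxx.
Qed.

Lemma in_edges G x y : ([set x; y] \in edges G) = adj G x y.
Proof.
apply/edgesP/idP => [[a [b [ab /set2_eq[][-> ->]]]]|xy] //; last by exists x, y.
by rewrite adj_sym.
Qed.

Lemma adj_neq G x y : adj G x y -> x != y.
Proof. by apply: contraTneq => ->; rewrite adj_irr. Qed.

Lemma card_edge G e : e \in edges G -> #|e| = 2.
Proof. by case/edgesP => x [y [/adj_neq xy ->]]; rewrite cards2 xy. Qed.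

Lemma edge_other G e x : e \in edges G -> x \in e ->
  exists2 y, adj G x y & e = [set x; y].
Proof.
case/edgesP => a [b [ab ->]] /set2P[->|->]; first by exists b.
by exists a; rewrite 1?adj_sym // setUC.
Qed.

Lemma sgraph_eq G H : edges G = edges H -> G = H.
Proof.
move=> eqE; have eqa : adj G = adj H.
  by apply/funext => x; apply/funext => y; rewrite -!in_edges eqE.
case: G H eqa {eqE} => [a s i] [a' s' i'] /= eqa; subst a'.
by rewrite (Prop_irrelevance s s') (Prop_irrelevance i i').
Qed.

Lemma keep_sym G (P : pred {set T}) :
  symmetric (fun x y => adj G x y && P [set x; y]).
Proof. by move=> x y; rewrite adj_sym setUC. Qed.

Lemma keep_irr G (P : pred {set T}) :
  irreflexive (fun x y => adj G x y && P [set x; y]).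
Proof. by move=> x; rewrite adj_irr. Qed.

(** All subgraphs keep the vertex type [T]: deleting a vertex only makes it isolated.
    An isolated vertex contributes nothing to the matching number or to the positive
    index, and its two contributions to the cyclomatic number cancel. *)
Definition keep G (P : pred {set T}) : sgraph T :=
  SGraph (keep_sym G P) (keep_irr G P).

Definition restr G A := keep G (fun e => e \subset A).
Definition vdel G v := restr G (~: [set v]).
Definition edel G x y := keep G (fun e => e != [set x; y]).

Lemma edges_keep G (P : pred {set T}) :
  edges (keep G P) = [set e in edges G | P e].
Proof.
apply/setP => e; rewrite [in RHS]inE; apply/edgesP/andP.
  by move=> [x [y [/andP[xy Pxy] ->]]]; rewrite in_edges.
by move=> [/edgesP[x [y [xy ->]]] Pxy]; exists x, y; rewrite /= xy.
Qed.

Lemma in_edges_restr G A e :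
  (e \in edges (restr G A)) = (e \in edges G) && (e \subset A).
Proof. by rewrite edges_keep [LHS]inE. Qed.

Lemma keep_sub G (P : pred {set T}) : edges (keep G P) \subset edges G.
Proof. by rewrite edges_keep; apply/subsetP => e; rewrite inE => /andP[]. Qed.

Lemma edges_subP G H :
  reflect (forall x y, adj G x y -> adj H x y) (edges G \subset edges H).
Proof.
apply: (iffP subsetP) => [sub x y|sub e]; first by rewrite -!in_edges => /sub.
by case/edgesP => x [y [/sub xy ->]]; rewrite in_edges.
Qed.

Lemma adj_restr G A x y :
  adj (restr G A) x y = [&& adj G x y, x \in A & y \in A].
Proof. by rewrite /= subUset !sub1set. Qed.

Lemma adj_vdel G v x y : adj (vdel G v) x y = [&& adj G x y, x != v & y != v].
Proof. by rewrite adj_restr !inE. Qed.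

Lemma restr_restr G A B : restr (restr G A) B = restr G (A :&: B).
Proof.
apply: sgraph_eq; rewrite !edges_keep; apply/setP => e.
by rewrite !inE -andbA subsetI.
Qed.

Lemma restrT G : restr G setT = G.
Proof.
apply: sgraph_eq; rewrite !edges_keep; apply/setP => e.
by rewrite !inE subsetT andbT.
Qed.

Lemma restrS G A B : A \subset B -> edges (restr G A) \subset edges (restr G B).
Proof.
move=> /subsetP s; apply/edges_subP => x y; rewrite !adj_restr.
by move=> /and3P[-> /s -> /s ->].
Qed.

Lemma edges_edel G x y : edges (edel G x y) = edges G :\ [set x; y].
Proof. by rewrite edges_keep; apply/setP => e; rewrite !inE andbC. Qed.

Lemma edel_sym G x y : edel G x y = edel G y x.
Proof. by apply: sgraph_eq; rewrite !edges_edel setUC. Qed.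

Lemma card_edges_edel G x y : adj G x y ->
  #|edges G| = #|edges (edel G x y)|.+1.
Proof. by move=> xy; rewrite edges_edel (cardsD1 [set x; y]) in_edges xy. Qed.

Lemma card_edges_vdel G x y : adj G x y -> #|edges (vdel G x)| < #|edges G|.
Proof.
move=> xy; apply: proper_card; apply/properP; split; first exact: keep_sub.
exists [set x; y]; first by rewrite in_edges.
by rewrite in_edges adj_vdel eqxx andbF.
Qed.

Lemma connect_symG G : connect_sym (adj G).
Proof. exact/sym_connect_sym/adj_sym. Qed.

Lemma connect_mono G H x y : edges G \subset edges H ->
  connect (adj G) x y -> connect (adj H) x y.
Proof.
by move=> /edges_subP s; apply: connect_sub => a b /s; exact: connect1.
Qed.

(** * Matchings and vertex covers *)

Lemma matching_geq G M : is_matching G M -> #|M| <= matching_number G.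
Proof. by move=> HM; apply: (leq_bigmax_cond (F := fun M : {set {set T}} => #|M|)). Qed.

Lemma matching_set0 G : is_matching G set0.
Proof. by rewrite /is_matching sub0set; apply/trivIsetP => A B; rewrite inE. Qed.

Lemma max_matching G : exists2 M, is_matching G M & matching_number G = #|M|.
Proof.
have [|M HM eqM] := @eq_bigmax_cond _ (is_matching G) (fun M : {set {set T}} => #|M|).
  by apply/card_gt0P; exists set0; apply: matching_set0.
by exists M.
Qed.

Lemma matching_sub G M N : is_matching G M -> N \subset M -> is_matching G N.
Proof.
move=> /andP[sM tM] sN; rewrite /is_matching (subset_trans sN sM).
exact: trivIsetS sN tM.
Qed.

Lemma matching_inj G M e f x : is_matching G M -> e \in M -> f \in M ->
  x \in e -> x \in f -> e = f.
Proof.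
move=> /andP[_ /trivIsetP tM] eM fM xe xf; apply: contraTeq xf => ef.
by have /(_ eM fM ef)/disjointFr-> := tM e f.
Qed.

Lemma matching_mono G H : edges G \subset edges H ->
  matching_number G <= matching_number H.
Proof.
move=> s; have [M /andP[sM tM] ->] := max_matching G.
by apply: matching_geq; rewrite /is_matching (subset_trans sM s).
Qed.

Lemma matchingU G M N : is_matching G M -> is_matching G N ->
  (forall e f, e \in M -> f \in N -> [disjoint e & f]) ->
  is_matching G (M :|: N) /\ #|M :|: N| = #|M| + #|N|.
Proof.
move=> /andP[sM tM] /andP[sN tN] dis; split.
  rewrite /is_matching subUset sM sN trivIsetU //.
  apply/pred0P => x /=; apply/negP => /andP[/bigcupP[e eM xe] /bigcupP[f fN xf]].
  by have := dis e f eM fN => /disjointFr/(_ xe); rewrite xf.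
suff MN0 : M :&: N = set0 by rewrite -cardsUI MN0 cards0 addn0.
apply/setP => e; rewrite !inE; apply/negP => /andP[eM eN].
have := dis e e eM eN; rewrite -setI_eq0 setIid => /eqP e0.
by have := card_edge (subsetP sM _ eM); rewrite e0 cards0.
Qed.

Lemma matching_vdel G v : matching_number G <= (matching_number (vdel G v)).+1.
Proof.
have [M HM ->] := max_matching G; pose N := [set e in M | v \in e].
rewrite -(cardsID N) -addn1 addnC leq_add //; last first.
  apply/card_le1_eqP => e f; rewrite !inE => /andP[eM /andP[_ ve]] /andP[fM /andP[_ vf]].
  exact: matching_inj HM fM eM vf ve.
apply: matching_geq; have /andP[sM tM] := HM.
rewrite /is_matching (trivIsetS _ tM) ?subsetDl // andbT edges_keep.
apply/subsetP => e; rewrite in_setD => /andP[eN eM]; rewrite inE (subsetP sM) //=.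
apply/subsetP => x xe; rewrite !inE; apply: contraNneq eN => xv.
by rewrite inE eM -xv.
Qed.

Lemma matching_restrU G A B : [disjoint A & B] ->
  matching_number (restr G A) + matching_number (restr G B)
    <= matching_number (restr G (A :|: B)).
Proof.
move=> dis; have [M HM ->] := max_matching (restr G A).
have [N HN ->] := max_matching (restr G B).
have subM : is_matching (restr G (A :|: B)) M.
  by case/andP: HM => sM tM; rewrite /is_matching tM andbT
    (subset_trans sM) // restrS // subsetUl.
have subN : is_matching (restr G (A :|: B)) N.
  by case/andP: HN => sN tN; rewrite /is_matching tN andbT
    (subset_trans sN) // restrS // subsetUr.
have [] := matchingU subM subN; last by move=> U <-; exact: matching_geq.
move=> e f eM fN; case/andP: HM => /subsetP/(_ _ eM); rewrite edges_keep inE.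
case/andP=> _ eA _; case/andP: HN => /subsetP/(_ _ fN); rewrite edges_keep inE.
case/andP=> _ fB _; exact: disjointW eA fB dis.
Qed.

Lemma matching_edge G A x y : adj G x y -> x \in A -> y \in A ->
  0 < matching_number (restr G A).
Proof.
move=> xy xA yA; have : is_matching (restr G A) [set [set x; y]].
  by rewrite /is_matching trivIset1 sub1set in_edges adj_restr xy xA yA.
by move/matching_geq; rewrite cards1.
Qed.

Lemma matching_path G x p : path (adj G) x p -> uniq (x :: p) ->
  (size (x :: p))./2 <= matching_number (restr G [set z in x :: p]).
Proof.
have [k] := ubnP (size p); elim: k x p => // k IH x [|y [|z p]] //= szp.
  move=> /andP[xy _] _; apply: (matching_edge xy); rewrite !inE eqxx ?orbT //.
move=> /and3P[xy yz pz] /and3P[]; rewrite !inE !negb_or.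
move=> /and3P[x1 x2 x3] /andP[y1 y2] U.
have IHz := IH z p (ltnW szp) pz U.
have dis : [disjoint [set x; y] & [set t in z :: p]].
  rewrite disjoint_subset; apply/subsetP => t; rewrite !inE => /orP[]/eqP->.
    by rewrite negb_or x2.
  by rewrite negb_or y1.
apply: leq_trans (leq_trans (matching_restrU G dis) (matching_mono _)).
  rewrite -add1n leq_add //.
  by apply: (matching_edge xy); rewrite !inE eqxx ?orbT.
apply: restrS; apply/subsetP => t; rewrite !inE => /orP[/orP[]->|/orP[]->] //; rewrite ?orbT //.
Qed.

Lemma matching_card_restr G A : (matching_number (restr G A)).*2 <= #|A|.
Proof.
have [M HM ->] := max_matching (restr G A); case/andP: HM => sM.
rewrite -(leq_card_cover M) => /eqP cE.
have -> : (#|M|).*2 = #|cover M|.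
  rewrite cE (eq_bigr (fun=> 2)); first by rewrite sum_nat_const muln2.
  by move=> e eM; apply: (@card_edge (restr G A)); exact: subsetP sM _ eM.
apply/subset_leq_card/bigcupsP => e /(subsetP sM).
by rewrite edges_keep inE => /andP[].
Qed.

Definition is_cover G K := forall x y, adj G x y -> (x \in K) || (y \in K).

Lemma matching_le_cover G K : is_cover G K -> matching_number G <= #|K|.
Proof.
move=> cK; have [M HM ->] := max_matching G.
pose f (e : {set T}) := [pick x in e :&: K].
have ex e : e \in M -> exists2 x, f e = Some x & x \in e :&: K.
  move=> eM; have /andP[/subsetP/(_ _ eM)/edgesP[x [y [xy eE]]] _] := HM.
  rewrite /f; case: pickP => [z|none]; first by exists z.
  have := cK _ _ xy; have := none x; have := none y.
  by rewrite !inE eE !inE !eqxx orbT /= => -> ->.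
have injf : {in M &, injective f}.
  move=> e1 e2 e1M e2M; have [x -> ] := ex e1 e1M; have [y ->] := ex e2 e2M.
  rewrite !inE => /andP[y2 _] /andP[x1 _] [eqxy]; rewrite -eqxy in y2.
  exact: matching_inj HM e1M e2M x1 y2.
rewrite -(card_in_imset injf) -(card_imset K (@Some_inj _)).
apply/subset_leq_card/subsetP => o /imsetP[e /ex[x -> xe] ->].
by rewrite imset_f //; move: xe; rewrite inE => /andP[].
Qed.

Definition is_leaf G x y := adj G x y /\ forall t, adj G x t -> t = y.

(** Once [y] is deleted the leaf [x] is isolated, so [xy] extends any matching. *)
Lemma matching_leaf G x y : is_leaf G x y ->
  matching_number (vdel G y) < matching_number G.
Proof.
move=> [xy leaf]; have [M HM ->] := max_matching (vdel G y).
have HM' : is_matching G M.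
  by case/andP: HM => sM tM; rewrite /is_matching tM (subset_trans sM (keep_sub _ _)).
have Hxy : is_matching G [set [set x; y]].
  by rewrite /is_matching trivIset1 sub1set in_edges xy.
have [e f eM|] := matchingU HM' Hxy.
  rewrite inE => /eqP ->; case/andP: HM => /subsetP/(_ _ eM)/edgesP[a [b [ab ->]]] _.
  move: ab; rewrite adj_vdel => /and3P[ab ay by_].
  have ax : a != x by apply: contraNneq by_ => ax; rewrite ax in ab; rewrite (leaf b).
  have bx : b != x.
    by apply: contraNneq ay => bx; rewrite bx adj_sym in ab; rewrite (leaf a).
  rewrite disjoint_subset; apply/subsetP => t; rewrite !inE negb_or.
  by case/orP => /eqP->; rewrite ?ax ?bx ?ay ?by_.
by move=> U; rewrite cards1 addn1 => <-; apply: matching_geq.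
Qed.

End Subgraphs.

(** * Cycles and bridges *)

Section Cycles.
Variable T : finType.
Implicit Types (G H : sgraph T) (A B S K : {set T}) (x y u v : T) (c : seq T).

Lemma cycle_adj_next G c x : is_cycle G c -> x \in c -> adj G x (next c x).
Proof. by case/and3P => _ cyc _; apply: next_cycle. Qed.

Lemma cycle_uniq G c : is_cycle G c -> uniq c.
Proof. by case/and3P. Qed.

Lemma cycle_edges_sub G c : is_cycle G c -> cycle_edges c \subset edges G.
Proof.
move=> cyc; apply/subsetP => e /imsetP[x xc ->].
by rewrite in_edges cycle_adj_next.
Qed.

Lemma mem_cycle_edges c x : x \in c -> [set x; next c x] \in cycle_edges c.
Proof. exact: imset_f. Qed.

Lemma is_cycle_sub G H c :
  is_cycle G c -> cycle_edges c \subset edges H -> is_cycle H c.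
Proof.
case/and3P => sz _ U sub; rewrite /is_cycle sz /ucycleb U andbT /=.
by apply: cycle_from_next => // x xc; rewrite -in_edges (subsetP sub) ?mem_cycle_edges.
Qed.

Lemma is_cycle_mono G H c :
  edges G \subset edges H -> is_cycle G c -> is_cycle H c.
Proof.
move=> s cyc; apply: is_cycle_sub (cyc) _.
exact: subset_trans (cycle_edges_sub cyc) s.
Qed.

Lemma cover_cycle_edges c : cover (cycle_edges c) = [set x in c].
Proof.
apply/setP => x; rewrite inE; apply/bigcupP/idP.
  by move=> [e /imsetP[y yc ->]] /set2P[]-> //; rewrite mem_next.
by move=> xc; exists [set x; next c x]; rewrite ?mem_cycle_edges ?set21.
Qed.

Lemma cycle_edge_mem c x y : [set x; y] \in cycle_edges c -> x \in c /\ y \in c.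
Proof.
move=> xy; have sub : [set x; y] \subset cover (cycle_edges c).
  by apply/subsetP => z zxy; apply/bigcupP; exists [set x; y].
by rewrite cover_cycle_edges subUset !sub1set !inE in sub; case/andP: sub.
Qed.

Lemma eq_cycle_edges_mem c1 c2 : cycle_edges c1 = cycle_edges c2 -> c1 =i c2.
Proof.
by move=> eqE x; have /setP/(_ x) := congr1 (@cover T) eqE;
   rewrite !cover_cycle_edges !inE.
Qed.

Lemma cycle_edgeP c x y : uniq c -> [set x; y] \in cycle_edges c ->
  y = next c x \/ y = prev c x.
Proof.
move=> U /imsetP[z zc /set2_eq[[-> ->]|[-> ->]]]; first by left.
by right; rewrite prev_next.
Qed.

Lemma in_cycle_vertices G x :
  reflect (exists2 c, is_cycle G c & x \in c) (x \in cycle_vertices G).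
Proof. by rewrite inE; apply: asboolP. Qed.

Definition bridge G x y := ~~ connect (adj (edel G x y)) x y.

Lemma cycle_not_bridge G c x : is_cycle G c -> x \in c -> ~~ bridge G x (next c x).
Proof.
move=> /and3P[sz cyc U] xc; rewrite /bridge negbK.
have [i p rc] := rot_to xc; rewrite -(next_rot i U) rc.
move: sz cyc U; rewrite -(rot_cycle i) -(rot_uniq i) -(size_rot i) rc.
case: p {rc} => [|y [|z p]] //= _ /and3P[xy yz pz] /and3P[].
rewrite !inE !negb_or => /and3P[xy' xz xp] /andP[yz' yp] _.
rewrite eqxx; set G' := edel G x y; rewrite (connect_symG G').
move: pz; rewrite rcons_path => /andP[pz lx].
have G'P a b : adj G a b -> a != x -> b != x -> adj G' a b.
  move=> ab ax bx; rewrite /= ab; apply/eqP => /set2_eq[][eqa eqb].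
    by rewrite eqa eqxx in ax.
  by rewrite eqb eqxx in bx.
have ly : last z p != y.
  apply/eqP => ly; have := mem_last z p; rewrite ly inE (negPf yp) orbF.
  by rewrite (negPf yz').
apply/connectP; exists (rcons (z :: p) x); last by rewrite last_rcons.
rewrite rcons_cons /=; apply/andP; split.
  by apply: (G'P _ _ yz); rewrite eq_sym.
rewrite rcons_path; apply/andP; split; last first.
  rewrite /= lx; apply/eqP => /set2_eq[][e1 e2]; last by rewrite e1 eqxx in ly.
  by rewrite e2 eqxx in xy'.
apply: (@sub_in_path _ (predC1 x)) pz.
  by move=> a b; rewrite !inE => ax bx ab; apply: G'P.
by rewrite /= eq_sym xz; apply/allP => t tp; rewrite /= ; apply: contraNneq xp => <-.
Qed.

Lemma next_last x p : uniq (x :: p) -> next (x :: p) (last x p) = x.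
Proof.
move=> /cycle_next /=; rewrite rcons_path => /andP[_ /eqP //].
Qed.

Lemma not_bridge_cycle G x y : adj G x y -> ~~ bridge G x y ->
  exists2 c, is_cycle G c & [set x; y] \in cycle_edges c.
Proof.
move=> xy; rewrite negbK => /connectP[q pq ey].
have := pq; case/shortenP: pq ey => p pp Up _ ey _.
exists (x :: p); last first.
  by apply/imsetP; exists y; rewrite ey ?mem_last // next_last // setUC.
have subp : path (adj G) x p by apply: sub_path pp => a b /andP[].
apply/and3P; split=> //; last by rewrite /= rcons_path subp /= -ey adj_sym.
case: p pp Up ey subp => [|z [|t p]] //=.
  by move=> _ _ yx; rewrite yx adj_irr in xy.
  by move=> /andP[/andP[_ /eqP ne] _] _ yz; case: ne; rewrite yz.
Qed.

Lemma bridge_mono G H x y : edges G \subset edges H -> bridge H x y -> bridge G x y.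
Proof.
move=> s; apply: contra; apply: connect_mono; rewrite !edges_edel.
exact: setSD.
Qed.

(** Phrased through bridges rather than through the absence of cycles, because a
    connection avoiding an edge lifts through a contraction directly, whereas a
    cycle would first have to be made free of repetitions. *)
Definition forest G := forall x y, adj G x y -> bridge G x y.

Lemma forest_mono G H : edges G \subset edges H -> forest H -> forest G.
Proof. by move=> s fH x y xy; apply: (bridge_mono s); apply/fH/(edges_subP _ _ s). Qed.

Lemma forestP G : forest G <-> (forall c, ~~ is_cycle G c).
Proof.
split=> [fG c|nc x y xy].
  apply/negP => cyc; have [x xc] : exists x, x \in c.
    by case: c cyc => // x c _; exists x; rewrite mem_head.
  by have := cycle_not_bridge cyc xc; rewrite fG ?cycle_adj_next.
by apply: contraT => /(not_bridge_cycle xy)[c cyc _]; have := nc c; rewrite cyc.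
Qed.

(** * The cyclomatic number under edge and vertex deletion *)

Lemma num_componentsE G : num_components G = #|[set x | fingraph.root (adj G) x == x]|.
Proof. by rewrite /num_components /n_comp_mem; apply: eq_card => x; rewrite !inE andbT. Qed.

(** A walk that uses the edge [xy] splits at its crossings of that edge. *)
Lemma connect_edel G x y a b : connect (adj G) a b ->
  [\/ connect (adj (edel G x y)) a b,
      connect (adj (edel G x y)) a x /\ connect (adj (edel G x y)) y b
    | connect (adj (edel G x y)) a y /\ connect (adj (edel G x y)) x b].
Proof.
set G' := edel G x y.
case/connectP => p; elim: p a => [|z p IH] a /=.
  by move=> _ ->; constructor 1; apply: connect0.
case/andP => az pz eb; have zb := IH z pz eb.
have [eaz|naz] := eqVneq [set a; z] [set x; y]; last first.
  have caz : connect (adj G') a z by apply: connect1; rewrite /= az.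
  by case: zb => [zb|[zx yb]|[zy xb]];
    [constructor 1|constructor 2; split=> //|constructor 3; split=> //];
    apply: connect_trans caz _.
have c0 := connect0 (adj G').
case: (set2_eq eaz) => [][-> eqz]; rewrite eqz in zb.
  case: zb => [yb|[yx yb]|[_ xb]]; last by constructor 1.
    by constructor 2.
  by constructor 2.
case: zb => [xb|[_ yb]|[xy xb]]; last by constructor 3.
  by constructor 3.
by constructor 1.
Qed.

(** The representative of [y] is the only one that can become redundant when the
    edge [xy] is restored. *)
Lemma num_components_edel_le G x y :
  num_components (edel G x y) <= (num_components G).+1.
Proof.
set G' := edel G x y; have sG := connect_symG G; have sG' := connect_symG G'.
rewrite !num_componentsE (cardsD1 (fingraph.root (adj G') y)) -add1n leq_add ?leq_b1 //.
have inj : {in [set a | fingraph.root (adj G') a == a] :\ fingraph.root (adj G') y &,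
    injective (fingraph.root (adj G))}.
  move=> a b; rewrite !inE => /andP[ay /eqP ra] /andP[by_ /eqP rb].
  move=> /(fingraph.rootP sG)/(@connect_edel _ x y)[/(fingraph.rootP sG')|[_ yb]|[ay' _]].
  - by rewrite ra rb.
  - by case/negP: by_; rewrite -rb eq_sym root_connect.
  - by case/negP: ay; rewrite -ra root_connect.
rewrite -(card_in_imset inj); apply/subset_leq_card/subsetP => _ /imsetP[a _ ->].
by rewrite inE root_root.
Qed.

Lemma num_components_edel_bridge G x y : adj G x y -> bridge G x y ->
  (num_components G).+1 <= num_components (edel G x y).
Proof.
move=> xy br; set G' := edel G x y; have sG := connect_symG G; have sG' := connect_symG G'.
rewrite !num_componentsE (cardsD1 (fingraph.root (adj G') y) [set a | fingraph.root (adj G') a == a]).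
rewrite inE root_root // eqxx ltnS.
apply: leq_trans (leq_imset_card (fingraph.root (adj G)) _).
apply/subset_leq_card/subsetP => a; rewrite inE => /eqP ra.
have [ay|nay] := boolP (connect (adj G') a y); last first.
  apply/imsetP; exists (fingraph.root (adj G') a).
    by rewrite !inE root_root // eqxx andbT root_connect.
  rewrite -[LHS]ra; apply/(fingraph.rootP sG); apply: connect_mono (connect_root _ _).
  exact: keep_sub.
apply/imsetP; exists (fingraph.root (adj G') x).
  by rewrite !inE root_root // eqxx andbT root_connect.
rewrite -[LHS]ra; apply/(fingraph.rootP sG); apply: (@connect_trans _ _ y).
  exact: connect_mono (keep_sub _ _) ay.
apply: (@connect_trans _ _ x); first by rewrite connect1 // adj_sym.
by apply: connect_mono (connect_root _ _); apply: keep_sub.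
Qed.

Lemma num_components_edel_cycle G x y : adj G x y -> ~~ bridge G x y ->
  num_components (edel G x y) = num_components G.
Proof.
move=> xy; rewrite negbK => br; apply: eq_n_comp => a b.
set G' := edel G x y in br *.
apply/idP/idP; first by apply: connect_mono; apply: keep_sub.
case/(@connect_edel _ x y) => [//|[ax yb]|[ay xb]].
  by apply: connect_trans ax _; apply: connect_trans br _.
by apply: connect_trans ay _; rewrite connect_symG in br; apply: connect_trans br _.
Qed.

Local Open Scope ring_scope.

(** Removing an edge either lowers the cyclomatic number by one or, for a bridge,
    creates a component instead.  All facts on [cyclomatic] below follow by removing
    edges one at a time. *)
Lemma cyclomatic_edel_cycle G x y : adj G x y -> ~~ bridge G x y ->
  cyclomatic G = cyclomatic (edel G x y) + 1.
Proof.
move=> xy br; rewrite /cyclomatic (num_components_edel_cycle xy br).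
by rewrite (card_edges_edel xy); lia.
Qed.

Lemma cyclomatic_edel_bridge G x y : adj G x y -> bridge G x y ->
  cyclomatic (edel G x y) = cyclomatic G.
Proof.
move=> xy br; have := num_components_edel_bridge xy br.
have := num_components_edel_le G x y.
by rewrite /cyclomatic (card_edges_edel xy); lia.
Qed.

Lemma cyclomatic_edel_le G x y : adj G x y -> cyclomatic (edel G x y) <= cyclomatic G.
Proof.
move=> xy; have [/(cyclomatic_edel_bridge xy)->//|/(cyclomatic_edel_cycle xy)->] :=
  boolP (bridge G x y); lia.
Qed.

Lemma cyclomatic_mono G H : edges H \subset edges G -> cyclomatic H <= cyclomatic G.
Proof.
have [k] := ubnP #|edges G :\: edges H|; elim: k G => // k IH G.
have [/eqP|[e]] := set_0Vmem (edges G :\: edges H).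
  rewrite setD_eq0 => GH _ HG.
  by rewrite (@sgraph_eq _ G H) //; apply/eqP; rewrite eqEsubset GH.
rewrite in_setD => /andP[eH eG] ltk HG; have [x [y [xy eE]]] := edgesP _ _ eG.
apply: le_trans (cyclomatic_edel_le xy); apply: IH.
  apply: leq_trans (_ : _ < #|edges G :\: edges H|)%N _ => //.
  apply: proper_card; apply/properP; rewrite edges_edel; split.
    by apply: setSD; apply: subD1set.
  by exists e; rewrite !in_setD ?in_set1 -?eE ?eqxx ?andbF // eH.
by rewrite edges_edel subsetD1 HG -eE.
Qed.

Lemma cyclomatic_ge0 G : 0 <= cyclomatic G.
Proof.
have := @cyclomatic_mono G (keep G pred0); rewrite keep_sub => /(_ isT).
apply: le_trans; rewrite /cyclomatic edges_keep.
have -> : [set e in edges G | pred0 e] = set0.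
  by apply/setP => e; rewrite in_set andbF in_set0.
rewrite cards0 num_componentsE; set R := [set x | _].
have -> : R = setT; last by rewrite cardsT; lia.
apply/setP => x; rewrite !inE; apply/eqP.
set e := adj _; have := connect_root e x; case/connectP => -[//|y p] /= /andP[].
by rewrite {1}/e /= andbF.
Qed.

Lemma cyclomatic_forest G : forest G -> cyclomatic G <= 0.
Proof.
have [k] := ubnP #|edges G|; elim: k G => // k IH G ltk fG.
have [E0|[e]] := set_0Vmem (edges G).
  rewrite /cyclomatic E0 cards0; suff : (num_components G <= #|T|)%N by lia.
  by rewrite num_componentsE max_card.
case/edgesP => x [y [xy _]].
rewrite -(cyclomatic_edel_bridge xy (fG _ _ xy)); apply: IH.
  by move: ltk; rewrite (card_edges_edel xy).
by apply: forest_mono fG; apply: keep_sub.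
Qed.

Lemma vdel_sub_edel G x y : edges (vdel G x) \subset edges (edel G x y).
Proof.
apply/edges_subP => a b; rewrite adj_vdel /= => /and3P[-> ax bx].
apply/eqP => /set2_eq[][ea eb]; first by rewrite ea eqxx in ax.
by rewrite eb eqxx in bx.
Qed.

Lemma cyclomatic_vdel_cycle G c x : is_cycle G c -> x \in c ->
  cyclomatic (vdel G x) <= cyclomatic G - 1.
Proof.
move=> cyc xc.
have := cyclomatic_edel_cycle (cycle_adj_next cyc xc) (cycle_not_bridge cyc xc).
have := cyclomatic_mono (vdel_sub_edel G x (next c x)); lia.
Qed.

Lemma cycle_next_closed c1 c2 x : uniq c1 -> x \in c1 -> x \in c2 ->
  {in c1, forall y, y \in c2 -> next c1 y \in c2} -> {subset c1 <= c2}.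
Proof.
move=> U xc xc2 cl y yc.
have : fconnect (next c1) x y by rewrite (fconnect_cycle (cycle_next U)).
move/iter_findex <-; move: (findex _ _ _) => n.
suff [] : iter n (next c1) x \in c1 /\ iter n (next c1) x \in c2 by [].
by elim: n => //= n [IH1 IH2]; rewrite mem_next cl.
Qed.

(** A walk along [c1] that starts on [c2] and never leaves it runs through all of
    [c1]. *)
Lemma cycles_branch c1 c2 x : uniq c1 -> x \in c1 -> x \in c2 ->
  cycle_edges c1 \subset cycle_edges c2
  \/ exists y, [/\ y \in c1, y \in c2 & [set y; next c1 y] \notin cycle_edges c2].
Proof.
move=> U xc1 xc2.
have [br|nobr] := pselect (exists y, [/\ y \in c1, y \in c2 &
  [set y; next c1 y] \notin cycle_edges c2]); [by right|left].
have step y : y \in c1 -> y \in c2 -> [set y; next c1 y] \in cycle_edges c2.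
  by move=> y1 y2; apply: contraT => ny; case: nobr; exists y.
have sub : {subset c1 <= c2}.
  apply: (cycle_next_closed U xc1 xc2) => y y1 y2.
  by have [] := cycle_edge_mem (step y y1 y2).
by apply/subsetP => e /imsetP[y yc ->]; apply: step (sub _ yc).
Qed.

(** The edge where [c1] leaves [c2] can be removed while [c2] survives; then an edge
    of [c2] at the same vertex can be removed as well. *)
Lemma cyclomatic_vdel_branch G c1 c2 y : is_cycle G c1 -> is_cycle G c2 ->
  y \in c1 -> y \in c2 -> [set y; next c1 y] \notin cycle_edges c2 ->
  cyclomatic (vdel G y) <= cyclomatic G - 2.
Proof.
move=> cyc1 cyc2 y1 y2 ny; set z := next c1 y in ny; set G' := edel G y z.
have cyc2' : is_cycle G' c2.
  apply: is_cycle_sub (cyc2) _; rewrite edges_edel subsetD1 ny andbT.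
  exact: cycle_edges_sub cyc2.
have := cyclomatic_edel_cycle (cycle_adj_next cyc1 y1) (cycle_not_bridge cyc1 y1).
have := cyclomatic_vdel_cycle cyc2' y2.
have : cyclomatic (vdel G y) <= cyclomatic (vdel G' y).
  apply: cyclomatic_mono; apply/edges_subP => a b; rewrite !adj_vdel.
  move=> /and3P[ab ay by_]; rewrite ay by_ /= ab !andbT.
  apply/eqP => /set2_eq[][ea eb]; first by rewrite ea eqxx in ay.
  by rewrite eb eqxx in by_.
rewrite -/z -/G'; lia.
Qed.

Lemma cyclomatic_vdel_meeting G c1 c2 : is_cycle G c1 -> is_cycle G c2 ->
  cycle_edges c1 != cycle_edges c2 -> ~~ [disjoint c1 & c2] ->
  exists2 y, y \in cycle_vertices G & cyclomatic (vdel G y) <= cyclomatic G - 2.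
Proof.
move=> cyc1 cyc2 neq /pred0Pn[x /andP[/= x1 x2]].
have [s12|[y [y1 y2 ny]]] := cycles_branch (cycle_uniq cyc1) x1 x2; last first.
  exists y; first by apply/in_cycle_vertices; exists c1.
  exact: cyclomatic_vdel_branch cyc1 cyc2 y1 y2 ny.
have [s21|[y [y2 y1 ny]]] := cycles_branch (cycle_uniq cyc2) x2 x1; last first.
  exists y; first by apply/in_cycle_vertices; exists c1.
  exact: cyclomatic_vdel_branch cyc2 cyc1 y2 y1 ny.
by case/negP: neq; rewrite eqEsubset s12.
Qed.

(** Removing an edge of a cycle destroys that cycle and creates none. *)
Lemma cyclomatic_le_cycles G (F : {set {set {set T}}}) :
  (forall c, is_cycle G c -> cycle_edges c \in F) -> cyclomatic G <= #|F|%:Z.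
Proof.
have [k] := ubnP #|F|; elim: k G F => // k IH G F ltk allF.
have [[c cyc]|nocyc] := pselect (exists c, is_cycle G c); last first.
  have fG : forest G.
    by apply/forestP => c; apply/negP => cyc; apply: nocyc; exists c.
  by have := cyclomatic_forest fG; lia.
have [x xc] : exists x, x \in c.
  by case: c cyc => // x c _; exists x; rewrite mem_head.
have xy := cycle_adj_next cyc xc; have nbr := cycle_not_bridge cyc xc.
rewrite (cyclomatic_edel_cycle xy nbr).
move: ltk; rewrite (cardsD1 (cycle_edges c)) allF // add1n => ltk.
have := IH (edel G x (next c x)) (F :\ cycle_edges c) ltk.
have H c' : is_cycle (edel G x (next c x)) c' ->
    cycle_edges c' \in F :\ cycle_edges c.
  move=> cyc'; rewrite !inE allF ?andbT; last first.
    by apply: is_cycle_mono cyc'; apply: keep_sub.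
  apply/eqP => eqE; have := cycle_edges_sub cyc'.
  by rewrite edges_edel subsetD1 eqE mem_cycle_edges // andbF.
by move=> /(_ H); rewrite -addn1 PoszD lerD2r.
Qed.

(** * Leaves of a graph, and covers of a forest *)

Definition component G x y : {set T} := [set t | connect (adj (edel G x y)) y t].

(** [S] stands for the empty set or the vertex set of a cycle.  Among the oriented
    edges [(a, v)] beyond which [S] is not reachable, one with the smallest far
    side ends at a leaf. *)
Lemma exists_leaf G S a v : adj G a v -> v \notin S ->
  (forall x y, adj G x y -> x \notin S -> bridge G x y) ->
  {in S &, forall x y, connect (adj (restr G S)) x y} ->
  exists x y, is_leaf G x y /\ x \notin S.
Proof.
move=> av vS br conS.
have [b [w [bw wS dis]]] : exists b w, [/\ adj G b w, w \notin S &
    [disjoint component G b w & S]].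
  have [dis|] := boolP [disjoint component G a v & S]; first by exists a, v.
  case/pred0Pn => s /= /andP[]; rewrite inE => vs sS.
  have dis : [disjoint component G v a & S].
    apply/pred0P => t /=; apply/negP => /andP[]; rewrite inE => at_ tS.
    rewrite edel_sym in vs; have := br v a; rewrite adj_sym => /(_ av vS).
    case/negP; apply: connect_trans vs _; rewrite connect_symG in at_.
    apply: connect_trans _ at_; apply: connect_mono (conS _ _ sS tS).
    apply/edges_subP => x y; rewrite adj_restr /= => /and3P[-> xS yS] /=.
    apply/eqP => /set2_eq[][ex ey]; first by rewrite -ex xS in vS.
    by rewrite -ey yS in vS.
  exists v, a; split=> //; first by rewrite adj_sym.
  by apply/negP => aS; have /disjointFr/(_ _) := dis => /(_ a);
     rewrite inE connect0 aS => /(_ isT).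
have [k] := ubnP #|component G b w|; elim: k b w bw wS dis => // k IH b w bw wS dis ltk.
have [leaf|noleaf] := pselect (forall t, adj G w t -> t = b).
  by exists w, b; split=> //; split=> //; rewrite adj_sym.
have [t [wt tb]] : exists t, adj G w t /\ t <> b.
  apply: contrapT => none; apply: noleaf => t wt.
  by apply: contrapT => tb; apply: none; exists t.
have tw : t \in component G b w.
  rewrite inE connect1 //= wt; apply/eqP => /set2_eq[][e1 e2] //.
  by have := adj_neq bw; rewrite e1 eqxx.
have tS : t \notin S by rewrite (disjointFr dis).
have wt' : w \notin component G w t.
  by rewrite inE connect_symG; apply: br.
have sub : component G w t \subset component G b w.
  apply/subsetP => s; rewrite !inE => /connectP[p pp ->].
  move: tw; rewrite inE => wt2; apply: connect_trans wt2 _.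
  apply/connectP; exists p => //.
  apply: (@sub_in_path _ (mem (component G w t)) (adj (edel G w t))) (pp).
    move=> x y xC yC /= /andP[-> _] /=; apply/eqP => /set2_eq[][e1 e2].
      by case/negP: wt'; move: yC; rewrite e2.
    by case/negP: wt'; move: xC; rewrite e1.
  apply/allP => x xp.
  suff : x \in component G w t by [].
  rewrite inE; exact: path_connect pp x xp.
apply: (IH w t wt tS).
  exact: disjointWl sub dis.
rewrite -ltnS; apply: leq_trans ltk; rewrite ltnS; apply: proper_card.
apply/properP; split=> //.
by exists w; rewrite // inE connect0.
Qed.

Lemma forest_leaf G : forest G -> edges G != set0 -> exists x y, is_leaf G x y.
Proof.
move=> fG /set0Pn[e /edgesP[x [y [xy _]]]].
have [|a b ab _|a b|a [b [ab _]]] := @exists_leaf G set0 x y xy.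
- by rewrite inE.
- exact: fG.
- by rewrite inE.
by exists a, b.
Qed.

(** König's theorem for forests: the neighbour of a leaf is put in the cover and
    pays for the edge that the leaf adds to a matching of the rest. *)
Lemma forest_cover G : forest G -> exists2 K, is_cover G K & (#|K| <= matching_number G)%N.
Proof.
have [k] := ubnP #|edges G|; elim: k G => // k IH G ltk fG.
have [E0|E0] := eqVneq (edges G) set0.
  by exists set0; rewrite ?cards0 // => x y; rewrite -in_edges E0 inE.
have [x [y leaf]] := forest_leaf fG E0.
have [||K cK ltK] := IH (vdel G y).
- by rewrite -ltnS (leq_trans _ ltk) // ltnS (card_edges_vdel (y := x)) // adj_sym; case: leaf.
- by apply: forest_mono fG; apply: keep_sub.
exists (y |: K).
  move=> a b ab; rewrite !inE.
  have [//|ay] := eqVneq a y; have [_|by_] := eqVneq b y; first by rewrite orbT.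
  by rewrite /=; apply: cK; rewrite adj_vdel ab ay.
rewrite (leq_trans _ (matching_leaf leaf)) // cardsU1.
by apply: leq_trans (_ : 1 + #|K| <= _)%N; rewrite ?leq_add2r ?leq_b1 // add1n ltnS.
Qed.

End Cycles.

(** * Transporting matchings along injections *)

Section Transport.
Variables (T1 T2 : finType) (f : T1 -> T2) (H1 : sgraph T1) (H2 : sgraph T2).
Hypothesis injf : injective f.

Lemma imset_set2 x y : f @: [set x; y] = [set f x; f y].
Proof. by rewrite imsetU !imset_set1. Qed.

Lemma matching_hom : (forall x y, adj H1 x y -> adj H2 (f x) (f y)) ->
  matching_number H1 <= matching_number H2.
Proof.
move=> fadj; have [M /andP[sM tM] ->] := max_matching H1.
have injF : injective (fun e : {set T1} => f @: e) by apply: imset_inj.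
rewrite -(card_imset M injF); apply: matching_geq.
rewrite /is_matching imset_trivIset // tM andbT.
apply/subsetP => _ /imsetP[e eM ->]; have /edgesP[x [y [xy ->]]] := subsetP sM _ eM.
by rewrite imset_set2 in_edges fadj.
Qed.

Lemma matching_preim : (forall x y, adj H2 (f x) (f y) -> adj H1 x y) ->
  (forall x y, adj H2 x y -> x \in codom f) ->
  matching_number H2 <= matching_number H1.
Proof.
move=> fadj cod; have [M /andP[sM tM] ->] := max_matching H2.
have rep e : e \in M -> exists x y, adj H1 x y /\ e = [set f x; f y].
  move=> eM; have /edgesP[x [y [xy ->]]] := subsetP sM _ eM.
  have /codomP[x' ex] := cod _ _ xy.
  have /codomP[y' ey] : y \in codom f by apply: (cod y x); rewrite adj_sym.
  by exists x', y'; rewrite ex ey in xy *; split=> //; apply: fadj.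
have pre x y : f @^-1: [set f x; f y] = [set x; y].
  by apply/setP => z; rewrite !inE !(inj_eq injf).
have injP : {in M &, injective (fun e : {set T2} => f @^-1: e)}.
  move=> e1 e2 /rep[x1 [y1 [_ ->]]] /rep[x2 [y2 [_ ->]]]; rewrite !pre => eqs.
  by rewrite -!imset_set2 eqs.
rewrite -(card_in_imset injP); apply: matching_geq; apply/andP; split.
  by apply/subsetP => _ /imsetP[e /rep[x [y [xy ->]]] ->]; rewrite pre in_edges.
apply/trivIsetP => _ _ /imsetP[e1 e1M ->] /imsetP[e2 e2M ->] neq.
have ne : e1 != e2 by apply: contraNneq neq => ->.
have dis := trivIsetP tM _ _ e1M e2M ne.
by apply/pred0P => z; rewrite /= !inE; apply/negP => /andP[z1 z2];
   rewrite (disjointFr dis z1) in z2.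
Qed.

End Transport.

Section Contraction.
Variable T : finType.
Implicit Types (G H : sgraph T) (A S K : {set T}) (x y u v : T) (c : seq T).
Implicit Types (cs : seq (seq T)).

Lemma matching_induced G A : matching_number (induced G A) = matching_number (restr G A).
Proof.
have inj : injective (fun x : {x : T | x \in A} => val x) by apply: val_inj.
apply/eqP; rewrite eqn_leq; apply/andP; split.
  apply: (matching_hom inj) => x y xy; rewrite adj_restr.
  by apply/and3P; split; [exact: xy | exact: valP | exact: valP].
apply: (matching_preim inj) => [x y|x y]; first by rewrite adj_restr => /and3P[].
rewrite adj_restr => /and3P[_ xA _]; apply/codomP.
by exists (exist _ x xA).
Qed.

(** * The contracted graph *)

Lemma occ_sym G : symmetric (on_common_cycle G).
Proof. by move=> x y; apply/asboolP/asboolP => -[c [? ? ?]]; exists c. Qed.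

Lemma occ_connect_sym G : connect_sym (on_common_cycle G).
Proof. exact/sym_connect_sym/occ_sym. Qed.

Lemma class_subproof G x :
  [set y in [set: T] | connect (on_common_cycle G) x y] \in cycle_classes G.
Proof. by apply/imsetP; exists x; rewrite ?inE //. Qed.

Definition class G x : {B : {set T} | B \in cycle_classes G} :=
  exist (fun B : {set T} => B \in cycle_classes G) _ (class_subproof G x).

Lemma in_class G x y : (y \in val (class G x)) = connect (on_common_cycle G) x y.
Proof. by rewrite /= !inE. Qed.

Lemma class_eq G x y : class G x = class G y <-> connect (on_common_cycle G) x y.
Proof.
split=> [eqc|cxy]; first by rewrite -in_class eqc in_class connect0.
apply/val_inj/setP => z; rewrite !in_class.
by rewrite (same_connect (occ_connect_sym G) cxy).
Qed.

Lemma class_mem G (B : {B : {set T} | B \in cycle_classes G}) x :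
  x \in val B -> B = class G x.
Proof.
case: B => B BP /= xB; have /imsetP[y _ eqB] := BP; apply: val_inj => /=.
move: xB; rewrite eqB !inE => /= yx.
by apply/setP => z; rewrite !inE (same_connect (occ_connect_sym G) yx).
Qed.

Lemma contractedP G (B1 B2 : {B : {set T} | B \in cycle_classes G}) : reflect
  (exists x y, [/\ class G x != class G y, adj G x y, B1 = class G x & B2 = class G y])
  (adj (contracted G) B1 B2).
Proof.
apply: (iffP andP) => [[ne /exists_inP[x xB /exists_inP[y yB xy]]]|].
  by exists x, y; rewrite -(class_mem xB) -(class_mem yB).
move=> [x [y [ne xy -> ->]]]; split=> //; apply/exists_inP; exists x.
  by rewrite in_class connect0.
by apply/exists_inP; exists y; rewrite // in_class connect0.
Qed.

Lemma common_cycle_class G c x y : is_cycle G c -> x \in c -> y \in c ->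
  class G x = class G y.
Proof.
by move=> cyc xc yc; apply/class_eq/connect1/asboolP; exists c.
Qed.

Lemma class_not_cycle G x y : x \notin cycle_vertices G ->
  class G x = class G y -> x = y.
Proof.
move=> xO /class_eq /connectP[[|z p] //= /andP[/asboolP[c [cyc xc _]] _] _].
by case/negP: xO; apply/in_cycle_vertices; exists c.
Qed.

(** A cycle of the contracted graph through the image of an edge [xy] would lift
    to a cycle of [G] through [xy], putting [x] and [y] in the same class. *)
Lemma forest_contracted G : forest (contracted G).
Proof.
move=> B1 B2 /contractedP[x [y [ne xy e1 e2]]]; rewrite e1 e2 {B1 B2 e1 e2}.
have br : bridge G x y.
  apply: contraNT ne => /(not_bridge_cycle xy)[c cyc /cycle_edge_mem[xc yc]].
  by rewrite (common_cycle_class cyc xc yc).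
set G' := edel G x y in br.
have occ a b : connect (on_common_cycle G) a b -> connect (adj G') a b.
  apply: connect_sub => {}a {}b /asboolP[c [cyc ac bc]].
  have cyc' : is_cycle G' c.
    apply: is_cycle_sub (cyc) _; rewrite edges_edel subsetD1 cycle_edges_sub //=.
    apply: contraNN ne => /cycle_edge_mem[xc yc].
    by rewrite (common_cycle_class cyc xc yc).
  by case/and3P: cyc' => _ cyc' _; apply: (connect_cycle cyc').
have lift B p a : path (adj (edel (contracted G) (class G x) (class G y))) B p ->
    B = class G a -> forall b, last B p = class G b -> connect (adj G') a b.
  elim: p B a => [|B' p IH] B a /=.
    by move=> _ -> b /class_eq; apply: occ.
  move=> /andP[/andP[/contractedP[a' [b' [_ ab eB eB']]] neq] pB'] eBa b lastB.
  have aa' : connect (adj G') a a' by apply/occ/class_eq; rewrite -eBa.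
  apply: connect_trans aa' _; apply: (@connect_trans _ _ b'); last exact: IH pB' eB' _ lastB.
  apply: connect1; rewrite /= ab; apply: contraNneq neq => eqab.
  by rewrite eB eB' -!imset_set1 -!imsetU eqab.
apply/negP => /connectP[p pp lastp]; case/negP: br.
exact: lift pp _ _ _.
Qed.

Lemma matching_contracted_ge G :
  matching_number (restr G (~: cycle_vertices G)) <= matching_number (contracted G).
Proof.
rewrite -matching_induced.
have out (x : {x | x \in ~: cycle_vertices G}) : val x \notin cycle_vertices G.
  by have := valP x; rewrite in_setC.
apply: (@matching_hom _ _ (fun x : {x | x \in ~: cycle_vertices G} => class G (val x))).
  by move=> x y /(class_not_cycle (out x)) /val_inj.
move=> x y xy; apply/contractedP; exists (val x), (val y); split=> //.
by apply: contraTneq xy => /(class_not_cycle (out x)) /val_inj ->; rewrite adj_irr.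
Qed.

(** A minimum cover of the contracted forest must already spend
    [matching_number (restr G (~: cycle_vertices G))] vertices off the cycles, so
    it contains no contracted cycle. *)
Lemma cover_off_cycles G :
  matching_number (contracted G) = matching_number (restr G (~: cycle_vertices G)) ->
  exists K, [/\ K \subset ~: cycle_vertices G,
    #|K| <= matching_number (restr G (~: cycle_vertices G)) &
    forall x y, adj G x y -> class G x != class G y -> (x \in K) || (y \in K)].
Proof.
move=> eqm; have [KT cKT leKT] := forest_cover (@forest_contracted G).
pose K := [set x in ~: cycle_vertices G | class G x \in KT].
have inKE x : (x \in K) = (x \notin cycle_vertices G) && (class G x \in KT).
  by rewrite in_set in_setC.
have injK : {in K &, injective (class G)}.
  by move=> x y; rewrite !inKE => /andP[xO _] _; apply: class_not_cycle xO.
have subK : class G @: K \subset KT.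
  by apply/subsetP => _ /imsetP[x + ->]; rewrite inKE => /andP[].
have cK : is_cover (restr G (~: cycle_vertices G)) K.
  move=> x y; rewrite adj_restr !in_setC => /and3P[xy xO yO].
  rewrite !inKE xO yO; apply: cKT.
  apply/contractedP; exists x, y; split=> //.
  by apply: contraTneq xy => /(class_not_cycle xO) ->; rewrite adj_irr.
have leK : #|K| <= #|KT| by rewrite -(card_in_imset injK) subset_leq_card.
have eqK : class G @: K = KT.
  apply/eqP; rewrite eqEcard subK card_in_imset //.
  by rewrite (leq_trans leKT) // eqm matching_le_cover.
exists K; split.
- by apply/subsetP => x; rewrite inKE in_setC => /andP[].
- by rewrite (leq_trans leK) // -eqm.
have inK x : class G x \in KT -> x \in K.
  rewrite -eqK => /imsetP[k kK eqc].
  have kO : k \notin cycle_vertices G by move: kK; rewrite inKE => /andP[].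
  by rewrite -(class_not_cycle kO (esym eqc)).
move=> x y xy ne; have := cKT (class G x) (class G y).
move=> /(_ _)/orP[|/inK->|/inK->]; rewrite ?orbT //.
by apply/contractedP; exists x, y.
Qed.

(** * Systems of disjoint cycles *)

(** A chord would be joined along the cycle, hence would lie on another cycle. *)
Lemma chordless G c x y : cycles_disjoint G -> is_cycle G c -> x \in c -> y \in c ->
  adj G x y -> [set x; y] \in cycle_edges c.
Proof.
move=> dis cyc xc yc xy; apply: contraT => nxy.
have cyc' : is_cycle (edel G x y) c.
  by apply: is_cycle_sub (cyc) _; rewrite edges_edel subsetD1 cycle_edges_sub.
have nbr : ~~ bridge G x y.
  rewrite negbK; have /and3P[_ cycc _] := cyc'; exact: connect_cycle cycc _ _ xc yc.
have [c' cycc' xyc'] := not_bridge_cycle xy nbr.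
have [eqE|neq] := eqVneq (cycle_edges c) (cycle_edges c'); first by rewrite eqE xyc' in nxy.
have /disjointFr/(_ xc) := dis _ _ cyc cycc' neq.
by case: (cycle_edge_mem xyc') => ->.
Qed.

Lemma pairwise_disjoint cs c1 c2 :
  pairwise (fun c1 c2 : seq T => [disjoint c1 & c2]) cs ->
  c1 \in cs -> c2 \in cs -> c1 != c2 -> [disjoint c1 & c2].
Proof.
elim: cs => //= c cs IH /andP[/allP dc pw]; rewrite !inE.
move=> /orP[/eqP->|c1s] /orP[/eqP->|c2s]; first by rewrite eqxx.
- by move=> _; apply: dc.
- by rewrite disjoint_sym => _; apply: dc.
- exact: IH.
Qed.

Definition cycle_system G cs :=
  [/\ {in cs, forall c, is_cycle G c},
      pairwise (fun c1 c2 : seq T => [disjoint c1 & c2]) cs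
    & forall c, is_cycle G c -> exists2 c', c' \in cs & cycle_edges c = cycle_edges c'].

Lemma exists_cycle_system G : cycles_disjoint G ->
  exists2 cs, cycle_system G cs & (cyclomatic G <= (size cs)%:Z)%R.
Proof.
move=> dis; pose P (E : {set {set T}}) c := is_cycle G c /\ cycle_edges c = E.
pose F := [set E | `[< exists c, P E c >]].
have /choice[rep repP] : forall E, exists c, E \in F -> P E c.
  move=> E; have [|nF] := boolP (E \in F); last by exists [::].
  by rewrite inE => /asboolP[c Pc]; exists c.
have inF c : is_cycle G c -> cycle_edges c \in F.
  by move=> cyc; rewrite inE; apply/asboolP; exists c.
exists [seq rep E | E <- enum F]; last first.
  by rewrite size_map -cardE; apply: cyclomatic_le_cycles.
split.
- by move=> _ /mapP[E + ->]; rewrite mem_enum => /repP[].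
- rewrite pairwise_map; have := enum_uniq F; rewrite uniq_pairwise.
  apply: (sub_in_pairwise (P := mem F)); last by apply/allP => E; rewrite mem_enum.
  move=> E1 E2 /repP[cyc1 e1] /repP[cyc2 e2] /= neq.
  by apply: dis; rewrite ?e1 ?e2.
- move=> c cyc; have [cyc' eqE] := repP _ (inF _ cyc).
  by exists (rep (cycle_edges c)); rewrite ?eqE // map_f // mem_enum inF.
Qed.

Lemma cycle_system_vertices G cs x : cycle_system G cs ->
  (x \in cycle_vertices G) = has (fun c => x \in c) cs.
Proof.
move=> [cyc _ all_c]; apply/in_cycle_vertices/hasP => [[c /all_c[c' c's eqE] xc]|].
  by exists c'; rewrite // -(eq_cycle_edges_mem eqE).
by move=> [c cin xc]; exists c => //; apply: cyc.
Qed.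

Lemma class_common_cycle G c x y : cycles_disjoint G -> is_cycle G c -> x \in c ->
  class G x = class G y -> y \in c.
Proof.
move=> dis cyc xc /class_eq/connectP[p pp ->].
elim: p x xc pp => [|z p IH] x xc //= /andP[/asboolP[c' [cyc' xc' zc']] pp].
apply: IH pp; have [/eq_cycle_edges_mem ->//|neq] :=
  eqVneq (cycle_edges c) (cycle_edges c').
by have := disjointFr (dis _ _ cyc cyc' neq) xc; rewrite xc'.
Qed.

Lemma class_edge G x y : cycles_disjoint G -> adj G x y ->
  class G x = class G y -> exists2 c, is_cycle G c & (x \in c) && (y \in c).
Proof.
move=> dis xy eqc; have [xO|xO] := boolP (x \in cycle_vertices G); last first.
  by rewrite -(class_not_cycle xO eqc) adj_irr in xy.
have [c cyc xc] := in_cycle_vertices _ _ xO.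
by exists c; rewrite // xc (class_common_cycle dis cyc xc eqc).
Qed.

Lemma matching_sum G cs (f : seq T -> {set T}) (B : {set T}) :
  pairwise (fun c1 c2 => [disjoint f c1 & f c2]) cs ->
  {in cs, forall c, [disjoint f c & B]} ->
  \sum_(c <- cs) matching_number (restr G (f c)) + matching_number (restr G B)
    <= matching_number G.
Proof.
elim: cs B => [|c cs IH] B.
  by rewrite big_nil add0n => _ _; apply/matching_mono/keep_sub.
rewrite /= => /andP[/allP dc pw] dB; rewrite big_cons addnAC.
have dcB : [disjoint f c & B] by apply: dB; rewrite mem_head.
apply: leq_trans (IH (f c :|: B) pw _); last first.
  move=> c' c's; rewrite -setI_eq0 setIUr setU_eq0 !setI_eq0 disjoint_sym dc //.
  by rewrite dB // inE c's orbT.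
by rewrite [X in _ <= X]addnC leq_add2r matching_restrU.
Qed.

Lemma matching_split G (As : seq {set T}) M : is_matching G M ->
  {in M, forall e : {set T}, has (fun A => e \subset A) As} ->
  #|M| <= \sum_(A <- As) matching_number (restr G A).
Proof.
elim: As M => [|A As IH] M HM; last rewrite big_cons.
  move=> none; suff -> : M = set0 by rewrite cards0.
  by apply/setP => e; rewrite inE; apply/negP => /none.
move=> cov; rewrite -(cardsID [set e : {set T} | e \subset A]) leq_add //.
  apply: matching_geq; have /andP[sM tM] := HM.
  rewrite /is_matching (trivIsetS (subsetIl _ _) tM) andbT.
  apply/subsetP => e /setIP[/(subsetP sM) eG]; rewrite in_set => eA.
  by rewrite in_edges_restr eG.
apply: IH; first exact: matching_sub HM (subsetDl _ _).
by move=> e /setDP[/cov /= /orP[eA|//]]; rewrite inE eA.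
Qed.

Lemma matching_cycle G c : is_cycle G c ->
  (size c)./2 <= matching_number (restr G [set x in c]).
Proof.
move=> cyc; case: c cyc => [|x p] cyc //; apply: matching_path (cycle_uniq cyc).
by case/and3P: cyc => _ /=; rewrite rcons_path => /andP[].
Qed.

Lemma matching_restr_cycle G c : (matching_number (restr G [set x in c])) <= (size c)./2.
Proof.
rewrite -[X in X <= _]doubleK half_leq // (leq_trans (matching_card_restr _ _)) //.
by rewrite cardsE; apply: card_size.
Qed.

Lemma pairwise_sets cs (f : seq T -> {set T}) : 
  {in cs, forall c, f c \subset [set x in c]} ->
  pairwise (fun c1 c2 : seq T => [disjoint c1 & c2]) cs ->
  pairwise (fun c1 c2 => [disjoint f c1 & f c2]) cs.
Proof.
move=> sub; apply: (sub_in_pairwise (P := mem cs)); last exact/allP.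
move=> c1 c2 /sub s1 /sub s2 dis.
apply: disjointWl s1 _; apply: disjointWr s2 _.
by apply/pred0P => x; rewrite /= !inE; have /pred0P/(_ x) := dis.
Qed.

Lemma matching_cycles_ge G cs : cycle_system G cs ->
  \sum_(c <- cs) (size c)./2 + matching_number (restr G (~: cycle_vertices G))
    <= matching_number G.
Proof.
move=> sys; have [cyc pw _] := sys.
apply: leq_trans (@matching_sum G cs (fun c => [set x in c]) (~: cycle_vertices G) _ _).
- rewrite leq_add2r big_seq [X in _ <= X]big_seq.
  by apply: leq_sum => c /cyc; apply: matching_cycle.
- exact: (@pairwise_sets cs (fun c => [set x in c])).
move=> c cin; rewrite disjoint_subset; apply/subsetP => x; rewrite in_set inE /= in_setC => xc.
by rewrite negbK; apply/in_cycle_vertices; exists c => //; apply: cyc.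
Qed.

(** Each contracted edge comes from an edge of [G].  A class meeting the lifts in two
    vertices would belong to two edges of the matching, or twice to the same one. *)
Lemma lift_matching G : exists L, [/\ is_matching G L,
  #|L| = matching_number (contracted G)
  & {in cover L &, injective (class G)}].
Proof.
have [M HM ->] := max_matching (contracted G).
have /choice[lift liftP] : forall e : {set {B : {set T} | B \in cycle_classes G}},
    exists E : {set T}, e \in M -> E \in edges G /\ class G @: E = e.
  move=> e; have [eM|eM] := boolP (e \in M); last by exists set0.
  have /andP[/subsetP/(_ _ eM)/edgesP[B1 [B2 [+ ->]]] _] := HM.
  move=> /contractedP[x [y [_ xy -> ->]]]; exists [set x; y] => _.
  by rewrite in_edges imsetU !imset_set1.
have injE e : e \in M -> {in lift e &, injective (class G)}.
  move=> eM; have [eG ee] := liftP e eM; apply/imset_injP.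
  have /andP[/subsetP/(_ _ eM) eT _] := HM.
  by rewrite ee (card_edge eG) (card_edge eT).
have sameE e1 e2 x y : e1 \in M -> e2 \in M -> x \in lift e1 -> y \in lift e2 ->
    class G x = class G y -> e1 = e2.
  move=> e1M e2M x1 y2 eqc; apply: (matching_inj HM e1M e2M (x := class G x)).
    by rewrite -(proj2 (liftP e1 e1M)) imset_f.
  by rewrite eqc -(proj2 (liftP e2 e2M)) imset_f.
have pickE e : e \in M -> exists x, x \in lift e.
  by move=> eM; apply/card_gt0P; rewrite (card_edge (proj1 (liftP e eM))).
exists (lift @: M); split.
- apply/andP; split; first by apply/subsetP => _ /imsetP[e /liftP[eG _] ->].
  apply/trivIsetP => _ _ /imsetP[e1 e1M ->] /imsetP[e2 e2M ->] neq.
  apply/pred0P => x /=; apply/negP => /andP[x1 x2]; case/eqP: neq.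
  by rewrite (sameE e1 e2 x x).
- apply: card_in_imset => e1 e2 e1M e2M eql; have [x x1] := pickE e1 e1M.
  by apply: (sameE e1 e2 x x) => //; rewrite -eql.
- move=> x y /bigcupP[_ /imsetP[e1 e1M ->] x1] /bigcupP[_ /imsetP[e2 e2M ->] y2] eqc.
  have e12 := sameE _ _ _ _ e1M e2M x1 y2 eqc; rewrite -e12 in y2.
  exact: injE e1M _ _ x1 y2 eqc.
Qed.

(** If a lifted edge is attached to a cycle, the vertex to delete is a neighbour of
    the attachment vertex, so that the remaining vertices form a path with an even
    number of vertices.  On the other cycles any vertex can be deleted, and the path
    that remains leaves one vertex unmatched. *)
Lemma matching_transversal G cs : cycles_disjoint G -> cycle_system G cs ->
  {in cs, forall c, ~~ odd (size c)} ->
  exists f : seq T -> {set T},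
  {in cs, forall c, exists2 x, x \in c & f c = [set x]} /\
  \sum_(c <- cs) (size c)./2.-1 + matching_number (contracted G)
    <= matching_number (restr G (~: \bigcup_(c <- cs) f c)).
Proof.
move=> dis sys even; have [cyc pw _] := sys.
have [L [HL <- injL]] := lift_matching G.
pose good c (XA : {set T} * {set T}) := [/\ exists2 x, x \in c & XA.1 = [set x],
  XA.2 \subset [set x in c], [disjoint XA.1 :|: XA.2 & cover L], [disjoint XA.1 & XA.2]
  & (size c)./2.-1 <= matching_number (restr G XA.2)].
have /choice[XA XAP] : forall c, exists XA, c \in cs -> good c XA.
  move=> c; have [cin|cin] := boolP (c \in cs); last by exists (set0, set0).
  have cycc := cyc c cin; have U := cycle_uniq cycc; have ev := even c cin.
  have [[u uc uL]|noL] := pselect (exists2 u, u \in c & u \in cover L).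
    have [i p rc] := rot_to uc; have memc z : (z \in c) = (z \in u :: p) by rewrite -rc mem_rot.
    have szc : size c = (size p).+1 by rewrite -(size_rot i) rc.
    have Up : uniq (u :: p) by rewrite -rc rot_uniq.
    have : cycle (adj G) (u :: p) by rewrite -rc rot_cycle; case/and3P: cycc.
    have cu z : z \in c -> z \in cover L -> z = u.
      by move=> zc zL; apply: injL => //; apply: common_cycle_class cycc zc uc.
    case: p rc memc szc Up => [|x p] rc memc szc Up.
      by have /andP[] := cycc; rewrite szc.
    rewrite /= rcons_path => /and3P[ux px _]; exists ([set x], [set z in p]) => _.
    have /and3P[] := Up; rewrite inE negb_or => /andP[neux nup] nxp Upp.
    split=> /=.
    - by exists x; rewrite // memc !inE eqxx orbT.
    - by apply/subsetP => z; rewrite !inE memc !inE => ->; rewrite !orbT.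
    - apply/pred0P => z /=; apply/negP => /andP[]; rewrite !inE => zxp zL.
      have zc : z \in c by rewrite memc !inE; case/orP: zxp => ->; rewrite !orbT.
      have zu := cu z zc zL; case/orP: zxp => [/eqP zx|zp].
        by rewrite -zu zx eqxx in neux.
      by rewrite -zu zp in nup.
    - by rewrite disjoints1 inE.
    - rewrite szc /=; case: p px nxp Upp {nup Up rc memc szc} => [|y p] //= /andP[_ py] _ Upp.
      by rewrite (matching_path py).
  have [x xc] : exists x, x \in c by case: c cycc {cin U ev noL} => // x c _; exists x; rewrite mem_head.
  have [i p rc] := rot_to xc; have memc z : (z \in c) = (z \in x :: p) by rewrite -rc mem_rot.
  have szc : size c = (size p).+1 by rewrite -(size_rot i) rc.
  have Up : uniq (x :: p) by rewrite -rc rot_uniq.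
  have : cycle (adj G) (x :: p) by rewrite -rc rot_cycle; case/and3P: cycc.
  have /andP[nxp Upp] := Up.
  rewrite /= rcons_path => /andP[px _]; exists ([set x], [set z in p]) => _; split=> /=.
  - by exists x.
  - by apply/subsetP => z; rewrite !inE memc !inE => ->; rewrite !orbT.
  - apply/pred0P => z /=; apply/negP => /andP[]; rewrite !inE => zxp zL.
    by apply: noL; exists z; rewrite // memc inE.
  - by rewrite disjoints1 inE.
  - case: p px {nxp Up rc memc} Upp szc => [|y p] /= px Upp szc; first by rewrite szc.
    have -> : (size c)./2.-1 = (size (y :: p))./2.
      by move: ev; rewrite szc /=; lia.
    by case/andP: px => _ py; apply: matching_path.
exists (fun c => (XA c).1); split; first by move=> c /XAP[].
set X := \bigcup_(c <- cs) _; set G' := restr G (~: X).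
have disX A : {in cs, forall c, [disjoint (XA c).1 & A]} -> A \subset ~: X.
  move=> dA; apply/subsetP => z zA; rewrite inE /X; apply/negP.
  rewrite big_seq; elim/big_ind: _; first by rewrite inE.
    by move=> A1 A2 n1 n2; rewrite inE => /orP[].
  by move=> c cin zc; have := disjointFr (dA c cin) zc; rewrite zA.
have disc c c' : c \in cs -> c' \in cs -> [disjoint (XA c).1 & (XA c').2].
  move=> cin c'in; have [_ sub2 _ dd _] := XAP c' c'in.
  have [[x xc X1] _ _ _ _] := XAP c cin.
  rewrite X1 disjoints1; apply/negP => xA.
  have xc' : x \in c' by have := subsetP sub2 _ xA; rewrite inE.
  have [ecc|necc] := eqVneq c c'; first by move: dd; rewrite -ecc X1 disjoints1 ecc xA.
  by have := disjointFr (pairwise_disjoint pw cin c'in necc) xc; rewrite xc'.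
have restrE A : A \subset ~: X -> restr G' A = restr G A.
  by move=> sA; rewrite restr_restr; congr (restr G _); apply/setIidPr.
have HL' : is_matching (restr G' (cover L)) L.
  have /andP[sL tL] := HL; rewrite /is_matching tL andbT restrE; last first.
    apply: disX => c /XAP[_ _ d _ _]; exact: disjointWl (subsetUl _ _) d.
  apply/subsetP => e eL; rewrite in_edges_restr (subsetP sL _ eL).
  by apply/subsetP => z ze; apply/bigcupP; exists e.
apply: leq_trans (_ : \sum_(c <- cs) matching_number (restr G' (XA c).2) +
    matching_number (restr G' (cover L)) <= _).
  rewrite leq_add ?(matching_geq HL') // big_seq [X in _ <= X]big_seq.
  apply: leq_sum => c cin; have [_ _ _ _ le] := XAP c cin; rewrite restrE //.
  by apply: disX => c' c'in; apply: disc.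
apply: (@matching_sum G' cs (fun c => (XA c).2)).
  by apply: pairwise_sets => // c /XAP[].
by move=> c /XAP[_ _ d _ _]; apply: disjointWl (subsetUr _ _) d.
Qed.

End Contraction.

Local Open Scope ring_scope.

Local Notation "M ^t*" := (map_mx Num.conj (trmx M)) : ring_scope.
Local Notation pos := num_pos_eigenvalues.

(** * The positive index of inertia of a Hermitian matrix *)

Definition qform (C : numClosedFieldType) n (A : 'M[C]_n) (x : 'rV[C]_n) : C :=
  (x *m A *m x^t*) 0 0.

Section Inertia.
Variable C : numClosedFieldType.
Implicit Types (n r k : nat).

Lemma tCK m n (A : 'M[C]_(m, n)) : (A^t*)^t* = A.
Proof. exact: trmxCK. Qed.

Lemma tC_mul m n p (A : 'M[C]_(m, n)) (B : 'M[C]_(n, p)) :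
  (A *m B)^t* = B^t* *m A^t*.
Proof. by rewrite trmx_mul map_mxM. Qed.

Lemma qform_mul m n (A : 'M[C]_n) (B : 'M[C]_(m, n)) x :
  qform A (x *m B) = qform (B *m A *m B^t*) x.
Proof. by rewrite /qform tC_mul !mulmxA. Qed.

Lemma qform_diag n (d : 'rV[C]_n) x :
  qform (diag_mx d) x = \sum_i d 0 i * `|x 0 i| ^+ 2.
Proof.
rewrite /qform mul_mx_diag !mxE; apply: eq_bigr => i _; rewrite !mxE normCK.
by rewrite mulrA [d 0 i * _]mulrC.
Qed.

Lemma spectral_decomposition n (A : 'M[C]_n) : A^t* = A ->
  exists (P : 'M_n) (d : 'rV_n), [/\ P *m P^t* = 1%:M, (forall i, d 0 i \is Num.real)
    & A = P^t* *m diag_mx d *m P].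
Proof.
move=> Ah; have Asym : A \is hermsymmx.
  by apply/is_hermitianmxP; rewrite expr0 scale1r.
have := hermitian_spectral_diag_real Asym.
have /hermitian_normalmx /orthomx_spectralP eqA := Asym.
move=> /mxOverP dR; exists (spectralmx A), (spectral_diag A); split=> //.
  by apply/unitarymxP/spectral_unitarymx.
by rewrite -invmx_unitary ?spectral_unitarymx.
Qed.

Lemma num_pos_eigenvaluesE n (P : 'M[C]_n) d : P *m P^t* = 1%:M ->
  pos (P^t* *m diag_mx d *m P) = #|[set i | 0 < d 0 i]|.
Proof.
move=> PU; set A := _ *m P; rewrite /num_pos_eigenvalues /eigenvalues.
case: closed_field_poly_normal => s /=.
have /monicP -> := char_poly_monic A; rewrite scale1r => eqs.
have charA : char_poly A = char_poly (diag_mx d).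
  rewrite /char_poly /char_poly_mx.
  have UP : map_mx polyC (P^t*) *m map_mx polyC P = 1%:M.
    by rewrite -map_mxM (mulmx1C PU) map_mx1.
  have -> : 'X%:M - map_mx polyC A = map_mx polyC (P^t*) *m
     ('X%:M - map_mx polyC (diag_mx d)) *m map_mx polyC P.
    rewrite mulmxBr mulmxBl scalar_mxC -[X in _ = X - _]mulmxA UP mulmx1; congr (_ - _).
    by rewrite !map_mxM.
  rewrite !det_mulmx mulrAC -det_mulmx UP det1 mul1r //.
have /prod_XsubC_eq peq : \prod_(z <- s) ('X - z%:P) =
    \prod_(z <- [seq d 0 i | i <- enum 'I_n]) ('X - z%:P).
  rewrite -eqs charA char_poly_trig ?diag_mx_is_trig // big_map big_enum /=.
  by apply: eq_bigr => i _; rewrite !mxE eqxx mulr1n.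
by rewrite (permP peq) count_map -sum1_count -sum1dep_card big_enum_cond.
Qed.

(** The two halves of the spectral decomposition: the span of the eigenvectors
    with positive eigenvalue, and its orthogonal complement given by as many
    linear equations. *)
Lemma positive_witness n (A : 'M[C]_n) : A^t* = A ->
  exists B : 'M[C]_(pos A, n), forall x, x != 0 -> 0 < qform A (x *m B).
Proof.
move=> /spectral_decomposition[P [d [PU dR ->]]]; rewrite num_pos_eigenvaluesE //.
set S := [set i | _]; pose f : 'I_#|S| -> 'I_n := enum_val.
exists (rowsub f P) => x x0; rewrite rowsubE mulmxA.
rewrite qform_mul !mulmxA PU mul1mx -mulmxA PU mulmx1 qform_diag.
have [j xj] : exists j, x 0 j != 0 by apply/rV0Pn.
have val i : (x *m rowsub f 1%:M) 0 (f i) = x 0 i.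
  rewrite mxE (bigD1 i) //= !mxE eqxx mulr1 big1 ?addr0 // => k ki.
  by rewrite !mxE (inj_eq enum_val_inj) (negPf ki) mulr0.
have out i : i \notin S -> (x *m rowsub f 1%:M) 0 i = 0.
  move=> iS; rewrite mxE big1 // => k _; rewrite !mxE.
  by case: eqP => [fk|_]; rewrite ?mulr0 //; rewrite -fk enum_valP in iS.
have ge0 i : 0 <= d 0 i * `|(x *m rowsub f 1%:M) 0 i| ^+ 2.
  have [iS|/out->] := boolP (i \in S); last by rewrite normr0 expr0n mulr0.
  by rewrite mulr_ge0 ?exprn_ge0 // ltW //; move: iS; rewrite inE.
rewrite (bigD1 (f j)) //= ltr_pwDl ?sumr_ge0 // val.
by rewrite mulr_gt0 ?exprn_gt0 ?normr_gt0 //; have := enum_valP j; rewrite inE.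
Qed.

Lemma nonpositive_witness n (A : 'M[C]_n) : A^t* = A ->
  exists L : 'M[C]_(n, pos A), forall x, x *m L = 0 -> qform A x <= 0.
Proof.
move=> /spectral_decomposition[P [d [PU dR ->]]]; rewrite num_pos_eigenvaluesE //.
set S := [set i | _]; pose f : 'I_#|S| -> 'I_n := enum_val.
exists (colsub f (P^t*)) => x; rewrite mulmx_colsub => xL.
rewrite -[P in _ *m P]tCK -qform_mul qform_diag.
rewrite -oppr_ge0 -sumrN sumr_ge0 // => i _.
rewrite -mulNr; have [iS|iS] := boolP (i \in S).
  have -> : i = f (enum_rank_in iS i) by rewrite /f enum_rankK_in.
  by have /matrixP/(_ 0 (enum_rank_in iS i)) := xL; rewrite !mxE => ->;
     rewrite normr0 expr0n mulr0.
rewrite mulr_ge0 ?exprn_ge0 // oppr_ge0 real_leNgt ?real0 //.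
by move: iS; rewrite inE.
Qed.

(** A subspace on which the form is positive meets trivially any subspace on
    which it is nonpositive; counting dimensions bounds the former by the
    number of equations defining the latter. *)
Lemma positive_le_equations n (A : 'M[C]_n) r k (B : 'M[C]_(r, n))
    (L : 'M[C]_(n, k)) :
  (forall x, x != 0 -> 0 < qform A (x *m B)) ->
  (forall x, x *m L = 0 -> qform A x <= 0) -> (r <= k)%N.
Proof.
move=> Bpos Lneg; rewrite leqNgt; apply/negP => ltkr.
have : kermx (B *m L) != 0.
  by rewrite kermx_eq0 -row_leq_rank -ltnNge (leq_ltn_trans (rank_leq_col _)).
case/rowV0Pn => x /sub_kermxP; rewrite mulmxA => /Lneg le0 /Bpos.
by move=> /lt_le_trans /(_ le0); rewrite ltxx.
Qed.

Lemma pos_ge n (A : 'M[C]_n) r (B : 'M[C]_(r, n)) : A^t* = A ->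
  (forall x, x != 0 -> 0 < qform A (x *m B)) -> (r <= pos A)%N.
Proof.
move=> /nonpositive_witness[L Lneg] Bpos; exact: positive_le_equations Bpos Lneg.
Qed.

Lemma pos_le n (A : 'M[C]_n) k (L : 'M[C]_(n, k)) : A^t* = A ->
  (forall x, x *m L = 0 -> qform A x <= 0) -> (pos A <= k)%N.
Proof.
move=> /positive_witness[B Bpos] Lneg; exact: positive_le_equations Bpos Lneg.
Qed.

Lemma pos_congr n (A D : 'M[C]_n) : A^t* = A ->
  (pos (D *m A *m D^t*) <= pos A)%N.
Proof.
move=> Ah; have [|B Bpos] := @positive_witness _ (D *m A *m D^t*).
  by rewrite !tC_mul tCK Ah mulmxA.
apply: (@pos_ge _ _ _ (B *m D)) => // x /Bpos.
by rewrite -qform_mul mulmxA.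
Qed.

Lemma posD n (A B : 'M[C]_n) : A^t* = A -> B^t* = B ->
  (pos (A + B) <= pos A + pos B)%N.
Proof.
move=> Ah Bh; have [L1 neg1] := nonpositive_witness Ah.
have [L2 neg2] := nonpositive_witness Bh.
apply: (@pos_le _ _ _ (row_mx L1 L2)); first by rewrite linearD map_mxD Ah Bh.
move=> x; rewrite mul_mx_row => /eqP; rewrite row_mx_eq0 => /andP[/eqP x1 /eqP x2].
rewrite /qform mulmxDr mulmxDl mxE -[leRHS]addr0.
by rewrite lerD ?neg1 ?neg2.
Qed.

Lemma rank_diag_mx n (d : 'rV[C]_n) : \rank (diag_mx d) = #|[set i | d 0 i != 0]|.
Proof.
set S := [set i | _]; pose f : 'I_#|S| -> 'I_n := enum_val.
apply/eqP; rewrite eqn_leq; apply/andP; split.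
  have -> : diag_mx d = colsub f (diag_mx d) *m rowsub f 1%:M.
    apply/matrixP => i j; rewrite !mxE; have [iS|iS] := boolP (i \in S).
      have ei : f (enum_rank_in iS i) = i by rewrite /f enum_rankK_in.
      rewrite (bigD1 (enum_rank_in iS i)) //= !mxE ei eqxx mulr1n big1 ?addr0.
        by rewrite mulr_natr.
      move=> k ki; rewrite !mxE -ei (inj_eq enum_val_inj) eq_sym (negPf ki).
      by rewrite mulr0n mul0r.
    move: (iS); rewrite inE negbK => /eqP ->; rewrite mul0rn big1 // => k _.
    rewrite !mxE; case: eqP => [ik|_]; last by rewrite mul0r.
    by rewrite ik enum_valP in iS.
  exact: leq_trans (mxrankM_maxl _ _) (rank_leq_col _).
have -> : #|S| = \rank (mxsub f f (diag_mx d)).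
  have -> : mxsub f f (diag_mx d) = diag_mx (\row_i d 0 (f i)).
    by apply/matrixP => i j; rewrite !mxE (inj_eq enum_val_inj).
  apply/esym/mxrank_unit; rewrite unitmxE det_diag unitfE.
  apply/prodf_neq0 => i _; rewrite mxE.
  by have := enum_valP i; rewrite inE.
have -> : mxsub f f (diag_mx d) = rowsub f 1%:M *m diag_mx d *m colsub f 1%:M.
  by rewrite -rowsubE -mxsub_mul mulmx1.
exact: leq_trans (mxrankM_maxl _ _) (mxrankM_maxr _ _).
Qed.

Lemma rank_inertia n (A : 'M[C]_n) : A^t* = A ->
  \rank A = (pos A + pos (- A))%N.
Proof.
move=> /spectral_decomposition[P [d [PU dR ->]]].
have -> : - (P^t* *m diag_mx d *m P) = P^t* *m diag_mx (- d) *m P.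
  by rewrite [diag_mx (- d)]linearN mulmxN mulNmx.
rewrite !num_pos_eigenvaluesE //.
have [uP uP'] := mulmx1_unit PU.
rewrite mxrankMfree ?row_free_unit // eqmxMfull ?row_full_unit // rank_diag_mx.
set S1 := [set i | 0 < d 0 i]; set S2 := [set i | 0 < (- d) 0 i].
have disj : S1 :&: S2 = set0.
  apply/setP => i; rewrite /S1 /S2 !inE mxE oppr_gt0; apply/negP => /andP[d1 d2].
  by have := lt_trans d1 d2; rewrite ltxx.
rewrite -cardsUI disj cards0 addn0.
by apply: eq_card => i; rewrite /S1 /S2 !inE mxE oppr_gt0 real_neqr_lt // orbC.
Qed.

(** ** Principal submatrices *)

Definition principal n (S : {set 'I_n}) (A : 'M[C]_n) : 'M[C]_n :=
  \matrix_(i, j) (if (i \in S) && (j \in S) then A i j else 0).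

Definition coord_proj n (S : {set 'I_n}) : 'M[C]_n :=
  diag_mx (\row_i (i \in S)%:R).

Lemma coord_proj_tC n (S : {set 'I_n}) : (coord_proj S)^t* = coord_proj S.
Proof.
apply/matrixP => i j; rewrite !mxE eq_sym; case: eqP => [->|_].
  by rewrite !mulr1n conjC_nat.
by rewrite !mulr0n conjC0.
Qed.

Lemma principalE n (S : {set 'I_n}) (A : 'M[C]_n) :
  principal S A = coord_proj S *m A *m (coord_proj S)^t*.
Proof.
rewrite coord_proj_tC; apply/matrixP => i j.
rewrite mul_mx_diag mul_diag_mx !mxE.
by case: (i \in S); case: (j \in S); rewrite /= ?mul1r ?mulr1 ?mul0r ?mulr0.
Qed.

Lemma hermE n (A : 'M[C]_n) i j : A^t* = A -> (A j i)^* = A i j.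
Proof. by move=> /matrixP/(_ i j); rewrite !mxE. Qed.

Lemma principal_herm n (S : {set 'I_n}) (A : 'M[C]_n) :
  A^t* = A -> (principal S A)^t* = principal S A.
Proof.
move=> Ah; apply/matrixP => i j; rewrite !mxE andbC.
by case: ifP => _; rewrite ?conjC0 ?(hermE i j Ah).
Qed.

Lemma pos_principal n (S : {set 'I_n}) (A : 'M[C]_n) : A^t* = A ->
  (pos (principal S A) <= pos A)%N.
Proof. by move=> Ah; rewrite principalE; apply: pos_congr. Qed.

Definition bform n (A : 'M[C]_n) (x y : 'rV[C]_n) : C := (x *m A *m y^t*) 0 0.

Lemma bformDl n (A : 'M[C]_n) x y z : bform A (x + y) z = bform A x z + bform A y z.
Proof. by rewrite /bform !mulmxDl mxE. Qed.
Lemma bformDr n (A : 'M[C]_n) x y z : bform A x (y + z) = bform A x y + bform A x z.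
Proof. by rewrite /bform linearD map_mxD mulmxDr mxE. Qed.
Lemma bformZl n (A : 'M[C]_n) a x y : bform A (a *: x) y = a * bform A x y.
Proof. by rewrite /bform -!scalemxAl mxE. Qed.
Lemma bformZr n (A : 'M[C]_n) a x y : bform A x (a *: y) = a^* * bform A x y.
Proof. by rewrite /bform linearZ map_mxZ -scalemxAr mxE. Qed.
Lemma bformC n (A : 'M[C]_n) x y : A^t* = A -> bform A y x = (bform A x y)^*.
Proof.
move=> Ah; rewrite /bform -{1}Ah.
transitivity (((x *m A *m y^t*)^t*) 0 0); last by rewrite !mxE.
by rewrite !tC_mul tCK mulmxA.
Qed.

(** The vector [z] is isotropic and orthogonal to every vector with zero [u]-th
    coordinate, itself included.  Correcting a positive subspace of the hyperplane
    by multiples of [z] makes it orthogonal to [delta_mx 0 u] as well, and the plane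
    spanned by these two vectors then contributes one more positive direction. *)
Lemma pos_hyperbolic n (A : 'M[C]_n) (z : 'rV_n) (a : C) u : A^t* = A ->
  z *m A = a *: delta_mx 0 u -> a != 0 -> z 0 u = 0 -> A u u = 0 ->
  (pos (principal (~: [set u]) A) < pos A)%N.
Proof.
move=> Ah zA a0 zu Auu.
have [B Bpos] := positive_witness (principal_herm (~: [set u]) Ah).
set D := coord_proj (~: [set u]); pose eu : 'rV[C]_n := delta_mx 0 u.
have zform b : bform A z b = a * (b 0 u)^*.
  rewrite /bform zA -scalemxAl mxE -rowE !mxE //.
have eform b : bform A b eu = (b *m A) 0 u.
  rewrite /bform; move: (b *m A) => w; rewrite mxE (bigD1 u) //= !mxE !eqxx conjC_nat mulr1.
  by rewrite big1 ?addr0 // => k ku; rewrite !mxE (negPf ku) andbF conjC_nat mulr0.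
(* [x *m c] is the multiple of [z] that makes [x *m (B *m D)] orthogonal to [eu]. *)
pose c := a^-1 *: (B *m D *m A *m eu^T).
(* The coefficient makes the cross term of [h] equal to [`|a| ^+ 2]. *)
pose h := a^* *: z + eu.
rewrite -addn1; apply: (@pos_ge _ _ _ (col_mx (B *m D - c *m z) h)) => // w.
rewrite -[w]hsubmxK; set x := lsubmx w; set tm := rsubmx w => w0.
pose t := tm 0 0; have tE : tm = t%:M := mx11_scalar tm.
rewrite mul_row_col tE mul_scalar_mx.
set y := x *m (B *m D); set s := bform A y eu.
have yu : y 0 u = 0.
  rewrite /y mulmxA mul_mx_diag !mxE; rewrite !inE eqxx mulr0 //.
have -> : x *m (B *m D - c *m z) + t *: h = y + ((t * a^* - s / a) *: z + t *: eu).
  rewrite /h scalerDr !addrA; congr (_ + _).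
  rewrite mulmxBr -/y -addrA; congr (_ + _).
  rewrite scalerBl scalerA addrC; congr (_ - _).
  rewrite /c -scalemxAl -scalemxAr !mulmxA.
  rewrite [x *m _ *m _ *m _ *m _]mx11_scalar mul_scalar_mx scalerA mulrC.
  congr ((_ / _) *: _); rewrite /s /bform /y !mulmxA; congr (fun_of_matrix _ _ _).
  by congr (_ *m _); apply/matrixP => i j; rewrite !mxE conjC_nat.
have yz : bform A y z = 0 by rewrite bformC // zform yu conjC0 mulr0 conjC0.
have zz : bform A z z = 0 by rewrite zform zu conjC0 mulr0.
have ee : bform A eu eu = 0 by rewrite eform -rowE mxE.
have ze : bform A z eu = a by rewrite zform mxE !eqxx conjC_nat mulr1.
rewrite /qform -/(bform _ _ _).
rewrite !(bformDl, bformDr, bformZl, bformZr) zz ee ze yz.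
rewrite (bformC y z Ah) (bformC y eu Ah) (bformC z eu Ah) yz ze -/s.
have Dpos : x != 0 -> 0 < bform A y y.
  have pE v : qform (principal (~: [set u]) A) v = qform A (v *m D).
    by rewrite qform_mul principalE.
  by move=> /Bpos; rewrite pE -mulmxA.
rewrite rmorphB !rmorphM /= conjCK fmorphV /= conjC0.
have ac0 : a^* != 0 by rewrite conjC_eq0.
set v := (v in 0 < v).
have -> : v = bform A y y + 2 * (`|t| ^+ 2 * `|a| ^+ 2).
  by rewrite !normCK /v; field; rewrite a0 ac0.
have tpos : t != 0 -> 0 < 2 * (`|t| ^+ 2 * `|a| ^+ 2).
  by move=> t0; rewrite !mulr_gt0 ?exprn_gt0 ?normr_gt0 // ltr0n.
have [x0|x0] := eqVneq x 0.
  have -> : bform A y y = 0 by rewrite /y x0 /bform !mul0mx mxE.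
  rewrite add0r tpos //; apply: contraNneq w0 => t0.
  by rewrite x0 tE t0 -scalemx1 scale0r row_mx0.
by rewrite ltr_wpDr ?Dpos // !mulr_ge0 ?exprn_ge0 ?ler0n.
Qed.

(** Sliding along a kernel vector [z] moves the whole space, isometrically, into
    the hyperplane of vanishing [w]-th coordinate. *)
Lemma pos_kernel n (A : 'M[C]_n) (z : 'rV_n) w : A^t* = A ->
  z *m A = 0 -> z 0 w != 0 -> (pos A <= pos (principal (~: [set w]) A))%N.
Proof.
move=> Ah zA zw; set D := coord_proj (~: [set w]).
pose S : 'M[C]_n := 1%:M - (z 0 w)^-1 *: ((delta_mx 0 w)^T *m z).
have SA : S *m A = A by rewrite mulmxBl mul1mx -scalemxAl -mulmxA zA mulmx0 scaler0 subr0.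
have SD : S *m D = S.
  apply/matrixP => i j; rewrite mul_mx_diag !mxE !inE big_ord1 !mxE eqxx /=.
  have [->|_] := eqVneq j w; last by rewrite mulr1.
  rewrite mulr0; have [_|_] := eqVneq i w; last by rewrite mul0r mulr0 subr0.
  by rewrite mul1r mulVf ?subrr.
have AS : A *m S^t* = A by rewrite -{1}Ah -tC_mul SA.
have {1}-> : A = S *m principal (~: [set w]) A *m S^t*.
  rewrite principalE -/D !mulmxA SD -[S *m A *m _ *m _]mulmxA -tC_mul SD.
  by rewrite SA AS.
exact: pos_congr (principal_herm _ Ah).
Qed.

(** If deleting [v] changes neither inertia index, it does not change the rank,
    so row [v] of [A] is a combination of the other rows. *)
Lemma kernel_vector n (A : 'M[C]_n) v : A^t* = A ->
  (pos A <= pos (principal (~: [set v]) A))%N ->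
  (pos (- A) <= pos (- principal (~: [set v]) A))%N ->
  exists2 z : 'rV[C]_n, z *m A = 0 & z 0 v = 1.
Proof.
move=> Ah posA negA; set D := coord_proj (~: [set v]).
have rkA : (\rank A <= \rank (D *m A))%N.
  rewrite (rank_inertia Ah) (leq_trans (leq_add posA negA)) //.
  by rewrite -rank_inertia ?principal_herm // principalE mxrankM_maxl.
have /submxP[Y eqA] : (A <= D *m A)%MS.
  by rewrite -(mxrank_leqif_sup (submxMl _ _)) // eqn_leq rkA mxrankM_maxr.
pose ev : 'rV[C]_n := delta_mx 0 v.
exists (ev - ev *m Y *m D).
  by rewrite mulmxBl -!mulmxA -eqA subrr.
have projv u : (u *m D) 0 v = 0 by rewrite mul_mx_diag !mxE !inE eqxx mulr0.
by rewrite [LHS]mxE [X in _ + X]mxE projv subr0 mxE !eqxx.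
Qed.

End Inertia.

(** * Weighted adjacency matrices *)

Section Weights.
Variables (C : numClosedFieldType) (n : nat).
Implicit Types (G H : sgraph 'I_n) (psi : 'I_n -> 'I_n -> C).
Implicit Types (A S K : {set 'I_n}) (x y u v : 'I_n) (c : seq 'I_n) (cs : seq (seq 'I_n)).

(** A gain function extended to all pairs of vertices, so that one function serves
    every subgraph. *)
Definition unit_weight psi :=
  (forall i j, `|psi i j| = 1) /\ (forall i j, psi j i = (psi i j)^*).

Definition wadj psi G : 'M[C]_n := \matrix_(i, j) (if adj G i j then psi i j else 0).

Definition opp_weight psi i j : C := - psi i j.

Lemma unit_weight_opp psi : unit_weight psi -> unit_weight (opp_weight psi).
Proof.
move=> [nrm herm]; split=> i j; rewrite /opp_weight; first by rewrite normrN.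
by rewrite herm rmorphN.
Qed.

Lemma wadj_opp psi G : wadj (opp_weight psi) G = - wadj psi G.
Proof. by apply/matrixP => i j; rewrite !mxE; case: ifP; rewrite ?oppr0. Qed.

Lemma wadj_restr psi G A : wadj psi (restr G A) = principal A (wadj psi G).
Proof.
apply/matrixP => i j; rewrite !mxE adj_restr.
by case: (adj G i j); case: ifP; rewrite ?if_same.
Qed.

Lemma wadj_diag psi G i : wadj psi G i i = 0.
Proof. by rewrite mxE adj_irr. Qed.

Section OneWeight.
Variable psi : 'I_n -> 'I_n -> C.
Hypothesis upsi : unit_weight psi.

Local Notation p G := (pos (wadj psi G)).

Lemma psiC i j : psi j i = (psi i j)^*. Proof. exact: upsi.2. Qed.

Lemma psi_neq0 i j : psi i j != 0.
Proof. by rewrite -normr_eq0 upsi.1 oner_eq0. Qed.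

Lemma psiK i j : psi i j * psi j i = 1.
Proof. by rewrite (psiC i j) -normCK upsi.1 expr1n. Qed.

Lemma wadj_herm G : (wadj psi G)^t* = wadj psi G.
Proof.
apply/matrixP => i j; rewrite !mxE adj_sym; case: ifP => _; last by rewrite conjC0.
by rewrite (psiC j i).
Qed.

Lemma pos_restr G A : (p (restr G A) <= p G)%N.
Proof. by rewrite wadj_restr; apply/pos_principal/wadj_herm. Qed.

Lemma pos_keep G (P : pred {set 'I_n}) :
  (p G <= p (keep G P) + p (keep G (predC P)))%N.
Proof.
have -> : wadj psi G = wadj psi (keep G P) + wadj psi (keep G (predC P)).
  apply/matrixP => i j; rewrite !mxE /=.
  by case: (adj G i j); case: (P _); rewrite /= ?addr0 ?add0r.
by apply: posD; apply: wadj_herm.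
Qed.

Lemma pos_cover G K : is_cover G K -> (p G <= #|K|)%N.
Proof.
move=> cK; pose f : 'I_#|K| -> 'I_n := enum_val.
apply: (@pos_le _ _ _ _ (colsub f 1%:M)); first exact: wadj_herm.
move=> x; rewrite mulmx_colsub mulmx1 => xK.
have x0 i : i \in K -> x 0 i = 0.
  move=> iK; have /matrixP/(_ 0 (enum_rank_in iK i)) := xK.
  by rewrite !mxE /f enum_rankK_in.
suff -> : qform (wadj psi G) x = 0 by [].
rewrite /qform mxE big1 // => j _; rewrite mxE.
have [jK|jK] := boolP (j \in K); first by rewrite !mxE x0 // conjC0 mulr0.
rewrite big1 ?mul0r // => i _; rewrite mxE; case: ifP => [ij|_]; last by rewrite mulr0.
by rewrite x0 ?mul0r //; have := cK i j ij; rewrite (negPf jK) orbF.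
Qed.

Lemma pos_restr_sum (As : seq {set 'I_n}) G :
  pairwise (fun A B : {set 'I_n} => [disjoint A & B]) As ->
  (p G <= \sum_(A <- As) p (restr G A)
          + p (keep G (fun e => ~~ has (fun A : {set 'I_n} => e \subset A) As)))%N.
Proof.
elim: As G => [|A As IH] G /=.
  rewrite big_nil add0n => _; suff -> : keep G xpredT = G by [].
  by apply: sgraph_eq; rewrite edges_keep; apply/setP => e; rewrite [LHS]inE andbT.
move=> /andP[/allP dA pw]; rewrite big_cons -addnA.
apply: leq_trans (pos_keep G (fun e => e \subset A)) _; rewrite leq_add2l.
set G1 := keep G _; apply: leq_trans (IH G1 pw) _; apply: leq_add.
  apply: eq_leq; rewrite big_seq [in RHS]big_seq; apply: eq_bigr => B BAs.
  congr (pos (wadj psi _)); apply: sgraph_eq; apply/setP => e.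
  rewrite !in_edges_restr edges_keep [e \in finset _]in_set /=.
  have [eG|//] := boolP (e \in edges G); have [eB|] := boolP (e \subset B); last first.
    by rewrite !andbF.
  rewrite !andbT /=; apply/negP => eA.
  have /card_gt0P[x xe] : (0 < #|e|)%N by rewrite (card_edge eG).
  by have := disjointFr (dA B BAs) (subsetP eA x xe); rewrite (subsetP eB x xe).
apply: eq_leq; congr (pos (wadj psi _)); apply: sgraph_eq; apply/setP => e.
by rewrite !edges_keep !(in_set, inE) /= negb_or andbA.
Qed.

(** The unit vector of a leaf is isotropic and sees only the neighbour of the leaf. *)
Lemma pos_leaf G x y : is_leaf G x y -> (p (vdel G y) < p G)%N.
Proof.
move=> [xy leaf]; rewrite wadj_restr.
apply: (@pos_hyperbolic _ _ _ (delta_mx 0 x) (psi x y)).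
- exact: wadj_herm.
- apply/rowP => j; rewrite -rowE !mxE eqxx /=.
  have [->|ny] := eqVneq j y; first by rewrite xy mulr1.
  rewrite mulr0; case: ifP => // /leaf ejy; by rewrite ejy eqxx in ny.
- exact: psi_neq0.
- by rewrite mxE /= eq_sym (negPf (adj_neq xy)).
- exact: wadj_diag.
Qed.

Lemma forest_pos_ge G : forest G -> (matching_number G <= p G)%N.
Proof.
have [k] := ubnP #|edges G|; elim: k G => // k IH G ltk fG.
have [E0|E0] := eqVneq (edges G) set0.
  rewrite (leq_trans (@matching_le_cover _ G set0 _)) ?cards0 //.
  by move=> x y; rewrite -in_edges E0 inE.
have [x [y leaf]] := forest_leaf fG E0.
have lt := pos_leaf leaf; have ltE : (#|edges (vdel G y)| < k)%N.
  by rewrite -ltnS (leq_trans _ ltk) // ltnS (card_edges_vdel (y := x)) // adj_sym; case: leaf.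
have := IH _ ltE (forest_mono (keep_sub _ _) fG).
have := matching_vdel G y; lia.
Qed.

(** Deleting a vertex on a cycle loses at most one matching edge and lowers the
    cyclomatic number, which reduces the bound to forests. *)
Lemma pos_ge_matching G :
  (matching_number G)%:Z - cyclomatic G <= (p G)%:Z.
Proof.
have [k] := ubnP #|edges G|; elim: k G => // k IH G ltk.
have [[c cyc]|nocyc] := pselect (exists c, is_cycle G c); last first.
  have fG : forest G by apply/forestP => c; apply/negP => cyc; apply: nocyc; exists c.
  by have := forest_pos_ge fG; have := cyclomatic_ge0 G; lia.
have [x xc] : exists x, x \in c.
  by case: c cyc => // x c _; exists x; rewrite mem_head.
have ltE : (#|edges (vdel G x)| < k)%N.
  by rewrite -ltnS (leq_trans _ ltk) // ltnS (card_edges_vdel (cycle_adj_next cyc xc)).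
have := IH _ ltE; have := pos_restr G (~: [set x]); rewrite -/(vdel G x).
by have := matching_vdel G x; have := cyclomatic_vdel_cycle cyc xc; lia.
Qed.

(** * Graphs attaining the lower bound *)

Definition extremal G := (p G)%:Z = (matching_number G)%:Z - cyclomatic G.

(** All the inequalities in the proof of the lower bound become equalities. *)
Lemma extremal_cycle G c x : extremal G -> is_cycle G c -> x \in c ->
  [/\ extremal (vdel G x), p (vdel G x) = p G,
      matching_number G = (matching_number (vdel G x)).+1
    & cyclomatic (vdel G x) = cyclomatic G - 1].
Proof.
rewrite /extremal => ext cyc xc; have := pos_ge_matching (vdel G x).
have := pos_restr G (~: [set x]); rewrite -/(vdel G x).
have := matching_vdel G x; have := cyclomatic_vdel_cycle cyc xc.
by move=> *; split; lia.
Qed.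

Lemma extremal_unmatched G v : extremal G ->
  matching_number (vdel G v) = matching_number G ->
  [/\ extremal (vdel G v), p (vdel G v) = p G & cyclomatic (vdel G v) = cyclomatic G].
Proof.
rewrite /extremal => ext eqm; have := pos_ge_matching (vdel G v).
have := pos_restr G (~: [set v]); rewrite -/(vdel G v).
have : cyclomatic (vdel G v) <= cyclomatic G by apply/cyclomatic_mono/keep_sub.
by move=> *; split; lia.
Qed.

Lemma extremal_leaf G x y : extremal G -> is_leaf G x y -> extremal (vdel G y).
Proof.
rewrite /extremal => ext leaf; have := pos_ge_matching (vdel G y).
have := pos_leaf leaf; have := matching_vdel G y.
have : cyclomatic (vdel G y) <= cyclomatic G by apply/cyclomatic_mono/keep_sub.
lia.
Qed.

(** Deleting a vertex at which two cycles diverge lowers the cyclomatic number by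
    two, which is more than an extremal graph allows. *)
Lemma extremal_disjoint G : extremal G -> cycles_disjoint G.
Proof.
move=> ext c1 c2 cyc1 cyc2 neq; apply: contraT => nd.
have [y /in_cycle_vertices[c cyc yc] le2] := cyclomatic_vdel_meeting cyc1 cyc2 neq nd.
by have [_ _ _] := extremal_cycle ext cyc yc; lia.
Qed.

Lemma extremal_transversal G cs (f : seq 'I_n -> {set 'I_n}) : extremal G ->
  {in cs, forall c, is_cycle G c} ->
  pairwise (fun c1 c2 : seq 'I_n => [disjoint c1 & c2]) cs ->
  {in cs, forall c, exists2 x, x \in c & f c = [set x]} ->
  (matching_number (restr G (~: \bigcup_(c <- cs) f c)) + size cs = matching_number G)%N.
Proof.
elim: cs G => [|c cs IH] G ext cycs; first by rewrite big_nil setC0 restrT addn0.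
rewrite /= => /andP[/allP dc pw] fP; have cyc := cycs c (mem_head _ _).
have [x xc fc] := fP c (mem_head _ _); have [ext' _ eqm _] := extremal_cycle ext cyc xc.
rewrite big_cons fc setCU -restr_restr -/(vdel G x) addnS IH //.
  move=> c' c's; have cyc' : is_cycle G c' by apply: cycs; rewrite inE c's orbT.
  apply: is_cycle_sub (cyc') _; apply/subsetP => e /imsetP[z zc' ->].
  rewrite in_edges adj_vdel (cycle_adj_next cyc' zc') /=.
  have nx t : t \in c' -> t != x.
    by move=> tc'; apply: contraTneq tc' => ->; rewrite (disjointFr (dc _ c's) xc).
  by rewrite !nx // mem_next.
by move=> c' c's; apply: fP; rewrite inE c's orbT.
Qed.

End OneWeight.
End Weights.

(** * The positive index of a cycle *)

Section NextIndex.
Variable T : eqType.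
Implicit Types (c : seq T).

Lemma next_nth_succ c x0 j : uniq c -> (j.+1 < size c)%N ->
  next c (nth x0 c j) = nth x0 c j.+1.
Proof.
move=> U lt; rewrite next_nth mem_nth ?(ltnW lt) // index_uniq ?(ltnW lt) //.
by case: c U lt => //= y s _ lt; apply: set_nth_default.
Qed.

Lemma next_nth_last c x0 j : uniq c -> j.+1 = size c ->
  next c (nth x0 c j) = nth x0 c 0.
Proof.
move=> U eqj; have lt : (j < size c)%N by rewrite -eqj.
rewrite next_nth mem_nth // index_uniq //.
by case: c U eqj {lt} => //= y s _ [->]; rewrite nth_default.
Qed.

Lemma index_next c x : uniq c -> x \in c ->
  index (next c x) c = if (index x c).+1 == size c then 0%N else (index x c).+1.
Proof.
move=> U xc; have lt : (index x c < size c)%N by rewrite index_mem.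
rewrite -[x in next c x](nth_index x xc); case: eqP => [eqs|/eqP ne].
  by rewrite next_nth_last // index_uniq // -eqs.
have lt' : ((index x c).+1 < size c)%N by rewrite ltn_neqAle ne.
by rewrite next_nth_succ // index_uniq.
Qed.

Lemma odd_index_next c x : uniq c -> ~~ odd (size c) -> x \in c ->
  odd (index (next c x) c) = ~~ odd (index x c).
Proof.
by move=> U ev xc; rewrite index_next //; case: eqP => // eqs; move: ev; rewrite -eqs /= negbK => ->.
Qed.

End NextIndex.

Section CycleIndex.
Variables (C : numClosedFieldType) (n : nat).
Implicit Types (G H : sgraph 'I_n) (A S K : {set 'I_n}) (x y u v : 'I_n) (c : seq 'I_n).

(** Along an even cycle the parity of the position changes across every edge; [y] is
    placed at position 0. *)
Lemma cycle_cover G c y : cycles_disjoint G -> is_cycle G c -> ~~ odd (size c) ->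
  y \in c -> exists K, [/\ y \in K, (#|K| <= (size c)./2)%N
    & is_cover (restr G [set x in c]) K].
Proof.
move=> dis cyc ev yc; have [i s rc] := rot_to yc; set c' := y :: s in rc.
have U : uniq c' by rewrite -rc rot_uniq (cycle_uniq cyc).
have memc x : (x \in c) = (x \in c') by rewrite -rc mem_rot.
have szc : size c = size c' by rewrite -rc size_rot.
exists [set x in c' | ~~ odd (index x c')]; split.
- by rewrite inE mem_head /= eqxx.
- pose f (i : 'I_(size c)./2) := nth y c' i.*2.
  rewrite -[X in (_ <= X)%N]card_ord; apply: leq_trans (leq_imset_card f predT).
  apply/subset_leq_card/subsetP => x; rewrite inE => /andP[xc' evx].
  have lt : ((index x c')./2 < (size c)./2)%N.
    have : (index x c' < size c')%N by rewrite index_mem.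
    by rewrite -szc; lia.
  apply/imsetP; exists (Ordinal lt) => //.
  have e : (index x c')./2.*2 = index x c' by lia.
  by rewrite -[f _]/(nth y c' (index x c')./2.*2) e nth_index.
move=> x z; rewrite adj_restr !in_set => /and3P[xz xc zc].
have /(cycle_edgeP (cycle_uniq cyc)) := chordless dis cyc xc zc xz.
have nxt t : t \in c -> odd (index (next c t) c') = ~~ odd (index t c').
  move=> tc; have <- : next c' t = next c t.
    by rewrite -rc (next_rot i (cycle_uniq cyc)).
  by rewrite odd_index_next -?szc // -memc.
rewrite -!memc xc zc /= => -[->|eqz]; first by rewrite nxt // orbN.
have -> : x = next c z by rewrite eqz next_prev // (cycle_uniq cyc).
by rewrite nxt // orNb.
Qed.

Variable psi : 'I_n -> 'I_n -> C.
Hypothesis upsi : unit_weight psi.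
Local Notation p G := (pos (wadj psi G)).

Definition weight_gain c : C := \prod_(x <- c) psi x (next c x).

Definition weight_typeA c := ~~ odd (size c) /\ weight_gain c = (-1) ^+ (size c)./2.

(** A vector on the vertices of odd position, in which consecutive entries
    cancel at the vertex between them.  Once around the cycle, the defect at the
    vertex of position 0 vanishes exactly for Type A. *)
Lemma cycle_vector G c : cycles_disjoint G -> is_cycle G c -> ~~ odd (size c) ->
  exists (z : 'rV[C]_n) a x y, [/\ x \in c, y \in c, z 0 x = 0 /\ z 0 y != 0,
    z *m wadj psi (restr G [set x in c]) = a *: delta_mx 0 x
    & (a == 0) = (weight_gain c == (-1) ^+ (size c)./2)].
Proof.
move=> dis cyc ev; have U := cycle_uniq cyc; set q := size c.
have qE : q = size c by [].
have q2 : (2 < q)%N by case/andP: cyc.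
have [u uc] : exists u, u \in c by case: c {U ev q qE q2} cyc => // u c _; exists u; rewrite mem_head.
pose w j := nth u c j.
have wc j : (j < q)%N -> w j \in c by apply: mem_nth.
have wi x : x \in c -> w (index x c) = x by apply: nth_index.
have iw j : (j < q)%N -> index (w j) c = j by move=> lt; apply: index_uniq.
pose zc := fix zc k := if k is k'.+1 then
  - zc k' * psi (w k'.*2.+1) (w k'.*2.+2) * psi (w k'.*2.+2) (w k'.*2.+3) else 1.
(* [zc k] is the entry at position [2 * k + 1]. *)
pose z : 'rV[C]_n := \row_i if (i \in c) && odd (index i c) then zc (index i c)./2 else 0.
pose a := zc (q.-1)./2 * psi (w q.-1) (w 0%N) + psi (w 1%N) (w 0%N).
have zE j : (j < q)%N -> z 0 (w j) = if odd j then zc j./2 else 0.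
  by move=> lt; rewrite mxE wc // iw.
exists z, a, (w 0%N), (w 1%N); split.
- by apply: wc; lia.
- by apply: wc; lia.
- by rewrite !zE ?oner_eq0 //; lia.
- apply/rowP => t; rewrite !mxE /=.
  have [tc|tc] := boolP (t \in c); last first.
    rewrite big1 => [|i _]; last first.
      by rewrite [wadj _ _ _ _]mxE adj_restr !inE (negPf tc) !andbF mulr0.
    have -> : (t == w 0%N) = false; last by rewrite mulr0.
    by apply: contraNF tc => /eqP->; apply: wc; lia.
  set s := prev c t; set r := next c t.
  have sc : s \in c by rewrite mem_prev.
  have rc : r \in c by rewrite mem_next.
  have tE : t = next c s by rewrite next_prev.
  have it := index_next U sc; rewrite -tE in it.
  have ir := index_next U tc; rewrite -/r in ir.
  have lts : (index s c < q)%N by rewrite index_mem.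
  have rs : r != s.
    apply/eqP => ers; move: ir it; rewrite ers -/q; move: q2 lts; clear.
    by case: ifP; case: ifP; lia.
  have adj_rs i : adj (restr G [set x in c]) i t -> i = r \/ i = s.
    rewrite adj_restr !inE => /and3P[it' ic _].
    have xt : adj G t i by rewrite adj_sym.
    exact: (cycle_edgeP U (chordless dis cyc tc ic xt)).
  have adjr : adj (restr G [set x in c]) r t.
    by rewrite adj_restr !inE rc tc adj_sym (cycle_adj_next cyc tc).
  have adjs : adj (restr G [set x in c]) s t.
    by rewrite adj_restr !inE sc tc tE (cycle_adj_next cyc sc).
  rewrite (bigD1 r) //= (bigD1 s) 1?eq_sym //= big1 ?addr0; last first.
    move=> i /andP[ir' is']; rewrite [wadj _ _ _ _]mxE; case: ifP; rewrite ?mulr0 //.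
    by move=> /adj_rs[] e; [rewrite e eqxx in ir'|rewrite e eqxx in is'].
  have zv i : i \in c -> z 0 i = if odd (index i c) then zc (index i c)./2 else 0.
    by move=> ic; rewrite -{1}(wi i ic) zE ?index_mem.
  rewrite (zv r rc) (zv s sc).
  rewrite ![wadj _ _ _ _]mxE adjr adjs.
  rewrite [w 0%N == t]eq_sym.
  have -> : (t == w 0%N) = (index t c == 0%N).
    apply/eqP/eqP => [->|it0]; first by rewrite iw // (ltn_trans _ q2).
    by rewrite -it0 wi.
  have [ods|evs] := boolP (odd (index s c)); last first.
    have -> : odd (index r c) = false.
      by rewrite odd_index_next // tE odd_index_next // negbK (negPf evs).
    rewrite !mul0r addr0; have -> : (index t c == 0%N) = false; last by rewrite mulr0.
    move: it; case: eqP => [eqs|_] ->; last by [].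
    by move: ev; rewrite -eqs /= (negPf evs).
  have odr : odd (index r c) by rewrite odd_index_next // tE odd_index_next // ods.
  rewrite odr; move: it; case: eqP => [eqs|neqs] it.
    rewrite it eqxx mulr1 /a addrC.
    have r1 : index r c = 1%N by rewrite ir it -qE; case: eqP q2 => [<-|].
    have eq_s : w q.-1 = s by rewrite qE -eqs /= wi.
    have eq_t : w 0%N = t by rewrite -(wi t tc) it.
    have eq_r : w 1%N = r by rewrite -(wi r rc) r1.
    rewrite eq_s eq_t eq_r r1 mul1r; congr (zc _ * _ + _).
    by rewrite qE -eqs.
  have r2 : index r c = (index s c).+2.
    rewrite ir it; case: eqP => // eqs; move: ev.
    by rewrite -eqs /= ods.
  have -> : (index t c == 0%N) = false by rewrite it.
  rewrite mulr0 r2 /=; set k := ((index s c)./2).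
  have sk : index s c = k.*2.+1 by rewrite -[LHS]odd_double_half ods.
  have <- : w k.*2.+1 = s by rewrite -sk wi.
  have eq_t : w k.*2.+2 = t by rewrite -sk -it wi.
  have eq_r : w k.*2.+3 = r by rewrite -sk -r2 wi.
  rewrite eq_t eq_r -!mulrA (psiK upsi) mulr1 mulNr addNr //.
have prodE k : psi (w 0%N) (w 1%N) * zc k =
    (-1) ^+ k * \prod_(0 <= j < k.*2.+1) psi (w j) (w j.+1).
  elim: k => [|k IH]; first by rewrite big_nat1 /= mulr1 expr0 mul1r.
  rewrite doubleS !big_nat_recr //= in IH *; rewrite exprS -!mulrA !mulrA.
  rewrite !mulrN !mulNr IH; ring.
have gainE : weight_gain c =
    (\prod_(0 <= j < q.-1) psi (w j) (w j.+1)) * psi (w q.-1) (w 0%N).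
  rewrite /weight_gain (big_nth u) -/q.
  have -> : q = q.-1.+1 by lia.
  rewrite big_nat_recr //=; congr (_ * psi _ _); last by rewrite next_nth_last // -/q; lia.
  apply: eq_big_nat => j /andP[_ lt]; rewrite next_nth_succ // -/q; lia.
have key : psi (w 0%N) (w 1%N) * a = 1 + (-1) ^+ (q.-1)./2 * weight_gain c.
  rewrite /a mulrDr mulrA prodE (psiK upsi) addrC gainE mulrA.
  by have -> : ((q.-1)./2).*2.+1 = q.-1 by lia.
rewrite -(mulrI_eq0 _ (lregP (psi_neq0 upsi (w 0%N) (w 1%N)))) key.
have -> : q./2 = ((q.-1)./2).+1 by lia.
move: (weight_gain c) => g; set e := (-1) ^+ _; rewrite exprS mulN1r -/e.
have ee : e * e = 1 by rewrite /e -expr2 sqrr_sign.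
apply/eqP/eqP => [eg|->]; last by rewrite mulrN ee subrr.
by rewrite -[g]mul1r -ee -mulrA -[e * g]add0r -{1}(subrr 1) -addrA (addrC (-1)) addrA eg add0r mulrN1.
Qed.

(** The kernel vector allows one vertex of a cover of size [(size c)./2] to be
    deleted for free. *)
Lemma pos_cycle_typeA G c : cycles_disjoint G -> is_cycle G c -> weight_typeA c ->
  (p (restr G [set x in c]) < (size c)./2)%N.
Proof.
move=> dis cyc [ev gain].
have [z [a [x [y [xc yc [zx zy] zA a0]]]]] := cycle_vector dis cyc ev.
have {a0} a0 : a = 0 by apply/eqP; rewrite a0 gain.
rewrite a0 scale0r in zA.
have := pos_kernel (wadj_herm upsi _) zA zy; rewrite -wadj_restr.
have [K [yK leK cK]] := cycle_cover dis cyc ev yc.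
have cK' : is_cover (restr (restr G [set x in c]) (~: [set y])) (K :\ y).
  move=> s t; rewrite adj_restr in_setC in_set1 in_setC in_set1 !in_setD1.
  by move=> /and3P[/cK st -> ->].
rewrite (cardsD1 y) yK add1n in leK; move=> le; apply: leq_ltn_trans le _.
exact: leq_ltn_trans (pos_cover upsi cK') leK.
Qed.

Lemma forest_cycle_minus G c x : cycles_disjoint G -> is_cycle G c -> x \in c ->
  forest (restr G ([set z in c] :\ x)).
Proof.
move=> dis cyc xc; apply/forestP => c'; apply/negP => cyc'.
have cycG : is_cycle G c' := is_cycle_mono (keep_sub _ _) cyc'.
have inc y : y \in c' -> y \in [set z in c] :\ x.
  by move=> yc'; have := cycle_adj_next cyc' yc'; rewrite adj_restr => /and3P[].
have [y yc'] : exists y, y \in c'.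
  by case: c' cyc' {cycG inc} => // y c' _; exists y; rewrite mem_head.
have [eqE|neq] := eqVneq (cycle_edges c') (cycle_edges c).
  have : x \in c' by rewrite (eq_cycle_edges_mem eqE).
  by move=> /inc; rewrite !inE eqxx.
have := disjointFr (dis _ _ cycG cyc neq) yc'.
by have := inc y yc'; rewrite !inE => /andP[_ ->].
Qed.

(** Deleting a vertex leaves a path; for an even cycle the vector of
    [cycle_vector] gives one more positive direction than the path. *)
Lemma pos_cycle_not_typeA G c : cycles_disjoint G -> is_cycle G c -> ~ weight_typeA c ->
  ((size c)./2 <= p (restr G [set x in c]))%N.
Proof.
move=> dis cyc ntA.
have minus x : x \in c -> (((size c).-1)./2 <= p (restr G ([set z in c] :\ x)))%N.
  move=> xc; apply: leq_trans (forest_pos_ge upsi (forest_cycle_minus dis cyc xc)).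
  have [i s rc] := rot_to xc; have szc : size c = (size s).+1 by rewrite -(size_rot i) rc.
  have Us : uniq (x :: s) by rewrite -rc rot_uniq (cycle_uniq cyc).
  have : cycle (adj G) (x :: s) by rewrite -rc rot_cycle; case/and3P: cyc.
  have -> : [set z in c] :\ x = [set z in s].
    apply/setP => z; rewrite !inE; have -> : (z \in c) = (z \in x :: s) by rewrite -rc mem_rot.
    rewrite inE; case: eqP => //= ->; by case/andP: Us => /negPf.
  rewrite szc /= rcons_path => /andP[px _]; case: s Us px {rc szc} => [|y s] //= /andP[_ U].
  by move=> /andP[_ py]; apply: matching_path.
have [od|ev] := boolP (odd (size c)).
  have [x xc] : exists x, x \in c.
    by case: c cyc {ntA minus od} => // x c _; exists x; rewrite mem_head.
  have -> : (size c)./2 = ((size c).-1)./2 by move: od; lia.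
  apply: leq_trans (minus x xc) _.
  by have := pos_restr upsi (restr G [set z in c]) (~: [set x]); rewrite restr_restr -setDE.
have [z [a [x [y [xc yc [zx zy] zA a0]]]]] := cycle_vector dis cyc ev.
have {}a0 : a != 0.
  by rewrite a0; apply/eqP => gain; apply: ntA.
have := pos_hyperbolic (wadj_herm upsi _) zA a0 zx (wadj_diag _ _ _).
rewrite -wadj_restr restr_restr -setDE; apply: leq_trans.
have half k : (2 < k)%N -> ~~ odd k -> k./2 = ((k.-1)./2).+1 by lia.
have /andP[sz _] := cyc; rewrite half //.
by rewrite ltnS; apply: minus.
Qed.

End CycleIndex.

(** * The characterization *)

Section Characterization.
Variables (C : numClosedFieldType) (n : nat).
Implicit Types (G H : sgraph 'I_n) (psi : 'I_n -> 'I_n -> C).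
Implicit Types (A S K : {set 'I_n}) (x y u v : 'I_n) (c : seq 'I_n) (cs : seq (seq 'I_n)).

Definition cactus_condition psi G :=
  [/\ cycles_disjoint G, forall c, is_cycle G c -> weight_typeA psi c
    & matching_number (contracted G) = matching_number (restr G (~: cycle_vertices G))].

Lemma weight_typeA_opp psi c : weight_typeA psi c -> weight_typeA (opp_weight psi) c.
Proof.
move=> [ev gain]; split=> //; rewrite -gain /weight_gain /opp_weight.
rewrite (eq_bigr (fun x => -1 * psi x (next c x))) => [|x _]; last by rewrite mulN1r.
rewrite big_split /= big_const_seq count_predT iter_mulr_1 -signr_odd (negPf ev).
by rewrite expr0 mul1r.
Qed.

Lemma cactus_condition_opp psi G :
  cactus_condition psi G -> cactus_condition (opp_weight psi) G.
Proof. by move=> [dis tA eqm]; split=> // c /tA; apply: weight_typeA_opp. Qed.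

(** A cover of the edges between classes by vertices off the cycles leaves, once
    deleted, only the disjoint cycles, each of positive index at most
    [(size c)./2 - 1]. *)
Lemma cactus_extremal psi G : unit_weight psi -> cactus_condition psi G -> extremal psi G.
Proof.
move=> upsi [dis tA eqm]; have [K [_ leK cK]] := cover_off_cycles eqm.
have [cs sys lec] := exists_cycle_system dis; have [cyc pw _] := sys.
have mge := matching_cycles_ge sys.
have pwS : pairwise (fun A B : {set 'I_n} => [disjoint A & B])
    [seq [set x in c] | c : seq 'I_n <- cs].
  by rewrite pairwise_map; apply: (@pairwise_sets _ cs (fun c => [set x in c])).
have := pos_restr_sum upsi G pwS; rewrite big_map; set S := \sum_(c <- cs) _; set G' := keep _ _ => le1.
have cK' : is_cover G' K.
  move=> x y /andP[xy /hasPn nc]; apply: cK => //; apply/eqP => eqc.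
  have [c cycc /andP[xc yc]] := class_edge dis xy eqc.
  have [_ _ /(_ _ cycc)[c' c's eqE]] := sys.
  have := nc [set x in c']; rewrite map_f // => /(_ isT).
  by rewrite subUset !sub1set !inE -!(eq_cycle_edges_mem eqE) xc yc.
have leC : (S + size cs <= \sum_(c <- cs) (size c)./2)%N.
  rewrite -sum1_size -big_split /= big_seq [X in (_ <= X)%N]big_seq.
  apply: leq_sum => c cin; have cc := cyc c cin; rewrite addn1.
  exact (pos_cycle_typeA upsi dis cc (tA c cc)).
have leK' := leq_trans (pos_cover upsi cK') leK; have := pos_ge_matching upsi G.
by rewrite /extremal; move: le1 lec mge leC leK'; clear; lia.
Qed.

Section OneStep.
Variable psi : 'I_n -> 'I_n -> C.
Hypothesis upsi : unit_weight psi.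
Local Notation p G := (pos (wadj psi G)).

Variable G : sgraph 'I_n.
Hypothesis ext : extremal psi G.
Hypothesis IH : forall H, (#|edges H| < #|edges G|)%N -> extremal psi H ->
  cactus_condition psi H.

Let dis : cycles_disjoint G := extremal_disjoint upsi ext.

Lemma extremal_opp_smaller H : (#|edges H| < #|edges G|)%N -> extremal psi H ->
  extremal (opp_weight psi) H.
Proof.
move=> lt extH; apply: cactus_extremal (unit_weight_opp upsi) _.
exact/cactus_condition_opp/IH.
Qed.

(** Suppose a maximum matching uses [uv].  It leaves [v] free in [G - u], so
    deleting [v] from [G - u] keeps it extremal and changes neither inertia index:
    row [v] depends on the other rows.  The dependency, cut down to the component
    of [v], meets [u] only through the edge [uv], and therefore adds one to the
    positive index when [u] is put back. *)
Lemma no_crossing M c u v : is_matching G M -> #|M| = matching_number G ->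
  is_cycle G c -> u \in c -> v \notin c -> [set u; v] \notin M.
Proof.
move=> HM maxM cyc uc vc; apply/negP => uvM.
have uv : adj G u v by rewrite -in_edges; case/andP: HM => /subsetP/(_ _ uvM).
set H := vdel G u.
have [extH pH mH _] := extremal_cycle upsi ext cyc uc; rewrite -/H in extH pH mH.
have ltH : (#|edges H| < #|edges G|)%N := card_edges_vdel uv.
have HM' : is_matching (vdel H v) (M :\ [set u; v]).
  have HMD := matching_sub HM (subsetDl M [set [set u; v]]).
  have /andP[sM tM] := HMD; rewrite /is_matching tM andbT.
  apply/subsetP => e; rewrite in_setD1 => /andP[ne eM].
  have eG : e \in edges G by case/andP: HM => /subsetP/(_ _ eM).
  have notin w : w \in [set u; v] -> w \notin e.
    by move=> wuv; apply: contraNN ne => we; rewrite (matching_inj HM eM uvM we wuv).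
  have /edgesP[x [y [xy eE]]] := eG.
  have ne' w : w \in [set u; v] -> (x != w) && (y != w).
    move=> /notin; rewrite eE !inE negb_or => /andP[].
    by rewrite eq_sym => ->; rewrite eq_sym => ->.
  have /andP[xu yu] := ne' u (set21 _ _); have /andP[xv yv] := ne' v (set22 _ _).
  by rewrite eE in_edges !adj_vdel xy xu yu xv yv.
have eqm : matching_number (vdel H v) = matching_number H.
  apply/eqP; rewrite eqn_leq matching_mono ?keep_sub //=.
  rewrite -ltnS -mH -maxM (cardsD1 [set u; v] M) uvM add1n ltnS.
  exact: matching_geq HM'.
have [extHv pHv cHv] := extremal_unmatched upsi extH eqm.
have ltHv : (#|edges (vdel H v)| < #|edges G|)%N.
  by apply: leq_ltn_trans ltH; apply/subset_leq_card/keep_sub.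
have oppH := extremal_opp_smaller ltH extH.
have oppHv := extremal_opp_smaller ltHv extHv.
have [z zA zv] : exists2 z : 'rV[C]_n, z *m wadj psi H = 0 & z 0 v = 1.
  apply: kernel_vector; first exact: wadj_herm.
    by rewrite -wadj_restr -/(vdel H v) pHv.
  rewrite -wadj_restr -!wadj_opp -/(vdel H v).
  by move: oppH oppHv; rewrite /extremal eqm cHv => <- [->].
pose z' : 'rV[C]_n := \row_i (if connect (adj H) v i then z 0 i else 0).
have vu : v != u by rewrite eq_sym (adj_neq uv).
have isou i : adj H i u = false by rewrite adj_vdel eqxx !andbF.
have only i : connect (adj H) v i -> adj G i u -> i = v.
  move=> vi iu; apply/eqP; apply: contraT => niv.
  have nbr : ~~ bridge G u v.
    rewrite negbK connect_symG; apply: connect_trans (connect_mono _ vi) _.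
      exact: vdel_sub_edel.
    apply: connect1; rewrite /= iu /=; apply/eqP => /set2_eq[][e1 e2].
      by have := adj_neq iu; rewrite e1 eqxx.
    by rewrite e1 eqxx in niv.
  have [c' cyc' /cycle_edge_mem[uc' vc']] := not_bridge_cycle uv nbr.
  have [eqE|neq] := eqVneq (cycle_edges c) (cycle_edges c').
    by rewrite (eq_cycle_edges_mem eqE) vc' in vc.
  by have := disjointFr (dis cyc cyc' neq) uc; rewrite uc'.
have z'u : z' 0 u = 0.
  rewrite mxE; case: ifP => [/connectP[q pq eu]|_]; last by [].
  case/lastP: q pq eu => [_ /= uv'|q t]; first by rewrite uv' eqxx in vu.
  by rewrite rcons_path last_rcons => /andP[_ lt] ut; rewrite -ut isou in lt.
have z'A : z' *m wadj psi G = psi v u *: delta_mx 0 u.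
  apply/rowP => j; rewrite !mxE /=; have [->|nju] := eqVneq j u.
    rewrite mulr1 (bigD1 v isT) /= big1.
      by rewrite addr0 [z' 0 v]mxE connect0 zv mul1r [wadj _ _ _ _]mxE adj_sym uv.
    move=> i niv; rewrite !mxE; case: ifP => [vi|]; last by rewrite mul0r.
    case: ifP => [iu|]; last by rewrite mulr0.
    by rewrite (only i vi iu) eqxx in niv.
  rewrite mulr0; have [vj|nvj] := boolP (connect (adj H) v j); last first.
    apply: big1 => i _; rewrite mxE; case: ifP => [vi|_]; last by rewrite mul0r.
    rewrite mxE; case: ifP => [ij|]; last by rewrite mulr0.
    have [iu|niu] := eqVneq i u.
      by have := z'u; rewrite mxE -iu vi => ->; rewrite mul0r.
    by case/negP: nvj; apply: connect_trans vi _; apply: connect1; rewrite adj_vdel ij niu.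
  have /rowP/(_ j) := zA; rewrite mxE [RHS]mxE => zAj; rewrite -[RHS]zAj.
  apply: eq_bigr => i _.
  have [eiu|niu] := eqVneq i u.
    by rewrite eiu z'u mul0r mxE adj_vdel eqxx andbF mulr0.
  rewrite mxE [wadj psi G i j]mxE [wadj psi H i j]mxE adj_vdel niu nju !andbT.
  case: ifP => [_|nvi]; first by [].
  case: ifP => [ij|_]; last by rewrite !mulr0.
  case/negP: (negbT nvi); apply: connect_trans vj _; apply: connect1.
  by rewrite adj_vdel adj_sym ij niu nju.
have := pos_hyperbolic (wadj_herm upsi G) z'A (psi_neq0 upsi v u) z'u (wadj_diag _ _ _).
by rewrite -wadj_restr -/(vdel G u) -/H pH ltnn.
Qed.

(** Deleting a vertex of another cycle, or the neighbour of a leaf, leads to a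
    smaller extremal graph still containing [c]; when neither exists, [c] carries
    all the edges. *)
Lemma extremal_typeA c : is_cycle G c -> weight_typeA psi c.
Proof.
move=> cyc; have cyc_vdel x : x \notin c -> is_cycle (vdel G x) c.
  move=> xc; apply: is_cycle_sub (cyc) _; apply/subsetP => e /imsetP[z zc ->].
  have nx t : t \in c -> t != x by move=> tc; apply: contraNneq xc => <-.
  by rewrite in_edges adj_vdel (cycle_adj_next cyc zc) !nx // mem_next.
have [[c' [cyc' neq]]|same] := pselect (exists c', is_cycle G c' /\
    cycle_edges c != cycle_edges c').
  have [x xc'] : exists x, x \in c'.
    by case: c' cyc' {neq} => // x c' _; exists x; rewrite mem_head.
  have [ext' _ _ _] := extremal_cycle upsi ext cyc' xc'.
  have lt := card_edges_vdel (cycle_adj_next cyc' xc').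
  have [_ tA _] := IH lt ext'; apply/tA/cyc_vdel.
  by rewrite (disjointFl (dis cyc cyc' neq) xc').
have memc c' x : is_cycle G c' -> x \in c' -> x \in c.
  move=> cyc' xc'; have [eqE|neq] := eqVneq (cycle_edges c) (cycle_edges c').
    by rewrite (eq_cycle_edges_mem eqE).
  by case: same; exists c'.
have [[a [v [av vc]]]|inside] := pselect (exists a v, adj G a v /\ v \notin c).
  have [|x y xy xS|x y xS yS|x [y [leaf xS]]] := @exists_leaf _ G [set z in c] a v av.
  - by rewrite inE.
  - apply: contraT => /(not_bridge_cycle xy)[c' cyc' /cycle_edge_mem[xc' _]].
    by move: xS; rewrite inE (memc _ _ cyc' xc').
  - rewrite !inE in xS yS; have cycS : is_cycle (restr G [set z in c]) c.
      apply: is_cycle_sub (cyc) _; apply/subsetP => e /imsetP[z zc ->].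
      by rewrite in_edges adj_restr !inE mem_next zc (cycle_adj_next cyc zc).
    have /and3P[_ cycc _] := cycS; exact: connect_cycle cycc _ _ xS yS.
  have yc : y \notin c.
    apply/negP => yc; have [_ py _ _] := extremal_cycle upsi ext cyc yc.
    by have := pos_leaf upsi leaf; rewrite py ltnn.
  have lt : (#|edges (vdel G y)| < #|edges G|)%N.
    by apply: (@card_edges_vdel _ _ _ x); rewrite adj_sym; case: leaf.
  by have [_ tA _] := IH lt (extremal_leaf upsi ext leaf); apply/tA/cyc_vdel.
have GE : restr G [set z in c] = G.
  apply: sgraph_eq; apply/eqP; rewrite eqEsubset keep_sub /=.
  have inc a v : adj G a v -> v \in c.
    by move=> av; apply: contraT => vc; case: inside; exists a, v.
  apply/edges_subP => x y xy; rewrite adj_restr !inE xy (inc _ _ xy).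
  by rewrite (inc y x) // adj_sym.
apply: contrapT => ntA; have := pos_cycle_not_typeA upsi dis cyc ntA.
have := matching_restr_cycle G c; rewrite GE.
have [x xc] : exists x, x \in c.
  by case: c cyc {cyc_vdel same memc inside GE ntA} => // x c _; exists x; rewrite mem_head.
have := cyclomatic_vdel_cycle cyc xc; have := cyclomatic_ge0 (vdel G x).
by move: ext; rewrite /extremal; lia.
Qed.

(** By [no_crossing] a maximum matching splits into matchings of the cycles and of
    the rest; this bounds [matching_number G] from above, and the transversal of
    [matching_transversal] bounds it from below through the contracted graph. *)
Lemma extremal_contracted :
  matching_number (contracted G) = matching_number (restr G (~: cycle_vertices G)).
Proof.
apply/eqP; rewrite eqn_leq matching_contracted_ge andbT.
have [cs sys _] := exists_cycle_system dis; have [cyc pw _] := sys.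
have even : {in cs, forall c, ~~ odd (size c)}.
  by move=> c /cyc /extremal_typeA[].
have [f [fP leT]] := matching_transversal dis sys even.
have := extremal_transversal upsi ext cyc pw fP => eqX.
have leM : (matching_number G <= matching_number (restr G (~: cycle_vertices G))
    + \sum_(c <- cs) (size c)./2)%N.
  have [M HM eqM] := max_matching G; rewrite eqM.
  apply: leq_trans (matching_split (As := (~: cycle_vertices G) ::
    [seq [set x in c] | c : seq 'I_n <- cs]) HM _) _; last first.
    rewrite big_cons big_map leq_add2l; apply: leq_sum => c _.
    exact: matching_restr_cycle.
  move=> e eM; have eG : e \in edges G by case/andP: HM => /subsetP/(_ _ eM).
  rewrite /= has_map; have [//|/subsetPn[x xe]] := boolP (e \subset _).
  rewrite in_setC negbK (cycle_system_vertices _ sys) => /hasP[c cin xc].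
  apply/hasP; exists c => //=; have [y xy eE] := edge_other eG xe.
  have yc : y \in c.
    apply: contraT => yc.
    by have := no_crossing HM (esym eqM) (cyc c cin) xc yc; rewrite -eE eM.
  by rewrite eE subUset !sub1set !inE xc yc.
have half : (\sum_(c <- cs) (size c)./2 = \sum_(c <- cs) (size c)./2.-1 + size cs)%N.
  rewrite -sum1_size -big_split /= big_seq [RHS]big_seq; apply: eq_bigr => c cin.
  have k2 k : (2 < k)%N -> (k./2 = k./2.-1 + 1)%N by lia.
  by apply: k2; have /andP[] := cyc c cin.
move: leT; rewrite -(leq_add2r (size cs)) eqX => /leq_trans/(_ leM).
by rewrite half addnAC [X in (_ <= X)%N -> _]addnC leq_add2l.
Qed.

End OneStep.

Lemma extremal_cactus psi G : unit_weight psi -> extremal psi G -> cactus_condition psi G.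
Proof.
move=> upsi; have [k] := ubnP #|edges G|; elim: k G => // k IHk G ltk ext.
have IH H : (#|edges H| < #|edges G|)%N -> extremal psi H -> cactus_condition psi H.
  by move=> lt; apply: IHk; apply: leq_trans lt _; rewrite -ltnS.
split; first exact: extremal_disjoint ext.
  exact: extremal_typeA ext IH.
exact: extremal_contracted ext IH.
Qed.

Definition extend_gain G (phi : unit_gain C G) i j : C :=
  if adj G i j then phi i j else 1.

Lemma extend_gain_unit G (phi : unit_gain C G) : unit_weight (extend_gain phi).
Proof.
have nrm i j : `|extend_gain phi i j| = 1.
  by rewrite /extend_gain; case: ifP => [/gain_norm|]; rewrite ?normr1.
split=> // i j; rewrite /extend_gain adj_sym; case: ifP => [ij|_]; last by rewrite conjC1.
rewrite gain_inv 1?adj_sym // invC_norm.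
by rewrite gain_norm // expr1n invr1 mul1r.
Qed.

End Characterization.

Theorem theorem3p8 (R : realType) (n : nat) (G : sgraph 'I_n)
    (phi : unit_gain R[i] G) (Gconn : connected_graph G) :
  (num_pos_eigenvalues (gain_adjacency phi))%:Z
    = (matching_number G)%:Z - cyclomatic G
  <->
  [/\ cycles_disjoint G,
      forall c : seq 'I_n, is_cycle G c -> typeA phi c
    & matching_number (contracted G)
        = matching_number (induced G (~: cycle_vertices G))].
Proof.
pose psi := extend_gain phi.
have upsi : unit_weight psi := extend_gain_unit phi.
have adjE : gain_adjacency phi = wadj psi G.
  by apply/matrixP => i j; rewrite !mxE /psi /extend_gain; case: ifP.
have gainE c : is_cycle G c -> cycle_gain phi c = weight_gain psi c.
  move=> cyc; rewrite /cycle_gain /weight_gain big_seq [RHS]big_seq.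
  by apply: eq_bigr => x xc; rewrite /psi /extend_gain (cycle_adj_next cyc xc).
rewrite adjE matching_induced; split=> [ext|[dis tA eqm]].
  have [dis tA eqm] := extremal_cactus upsi ext; split=> // c cyc.
  by rewrite /typeA gainE //; apply: tA.
apply: (cactus_extremal upsi); split=> // c cyc.
by have := tA c cyc; rewrite /typeA gainE.
Qed.
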